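(* Let $A(x)$ satisfy the assumptions in the context (real symmetric, uniformly nondegenerate, Schwartz perturbation of $A_h$, non-trapping), and for $1<R\le\infty$ let $(X^R(s;x,\xi),\Xi^R(s;x,\xi))$ be the bicharacteristic flow of the truncated matrix $A^R$. There exist $c_1,c_2,c_3>0$ and $M_1>0$ (sufficiently large) such that for any $(x,\xi)\in\mathbb R^n\times\mathbb S^{n-1}$ and $R>2M_1$ one has: (i) the bicharacteristic flow $(X^R(s;x,\xi),\Xi^R(s;x,\xi))$ exists for any $s\in\mathbb R$; (ii) $0<c_1^{-1}\le|\Xi^R(s;x,\xi)|\le c_1$ for all $s\in\mathbb R$; (iii) there exists $\tilde s_0\in\mathbb R$ such that $$\frac{d}{ds}|X^R(s;x,\xi)|^2\Big|_{s=\tilde s_0}\ge0\quad\text{and}\quad|X^R(\tilde s_0;x,\xi)|\ge M_1;\tag{$*$}$$ (iv) if $s_0=\inf\{\tilde s_0\ge0:( * )\text{ holds}\}$, then $$|X^R(s;x,\xi)|^2\ge c_2(s-s_0)^2+M_1^2,\qquad s\ge s_0;$$ (v) for every $j\in\{1,2,\dots\}$ the set $$I_j^R=\{s\in[0,s_0]:2^j\le|X^R(s;x,\xi)|\le2^{j+1}\}$$ satisfies $|I_j^R|\le c_32^j$ (Lebesgue measure).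
   Context: Assumptions on $A$: $n\ge2$; $A(x)=(a_{jk}(x))$ is a real symmetric matrix of smooth functions on $\mathbb R^n$; there is $\nu>0$ with $\nu^{-1}|\xi|\le|A(x)\xi|\le\nu|\xi|$ for all $x,\xi$; $a_{jk}(x)-a^0_{jk}\in\mathcal S(\mathbb R^n)$ for all $j,k$, where $(a^0_{jk})=A_h=\begin{pmatrix}I_k&0\\0&-I_{n-k}\end{pmatrix}$, $k\in\{1,\dots,n-1\}$; and $A$ is non-trapping. The bicharacteristic flow of a symmetric matrix function $A$ is the solution of $\frac{d}{ds}X_j=2\sum_ka_{jk}(X)\Xi_k$, $\frac{d}{ds}\Xi_j=-\sum_{k,l}\partial_{x_j}a_{kl}(X)\Xi_k\Xi_l$, $(X,\Xi)(0;x_0,\xi_0)=(x_0,\xi_0)$, on $(-\delta,\delta)$, $\delta=\delta(x_0,\xi_0)$. Non-trapping: for each $x_0\in\mathbb R^n$, $\xi_0\in\mathbb R^n\setminus\{0\}$ and $\mu>0$ there is $s_0$ with $0<s_0<\delta(x_0,\xi_0)$ and $|X(s_0;x_0,\xi_0)|\ge\mu$. Truncation: $\theta\in C_0^\infty(\mathbb R^n)$ is fixed with $0\le\theta\le1$, $\mathrm{supp}\,\theta\subset\{|x|\le2\}$, $\theta=1$ on $\{|x|\le1\}$; $A^R(x)=\theta(x/R)A(x)+(1-\theta(x/R))A_h$ for $1<R<\infty$, and $A^\infty=A$. *)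

(* Defs.v *)
From HB Require Import structures.
From mathcomp Require Export all_boot all_order all_algebra.
From mathcomp Require Export all_classical all_reals all_analysis.
Export Order.TTheory GRing.Theory Num.Theory.
Export numFieldNormedType.Exports.

Set Implicit Arguments.
Unset Strict Implicit.
Unset Printing Implicit Defensive.

Local Open Scope classical_set_scope.
Local Open Scope ring_scope.

(* The library norm `|x| on 'cV[R]_n is the sup norm (used only through the
   topology it induces); the Euclidean norm |x| is enorm. *)
Definition enorm (R : realType) (n : nat) (x : 'cV[R]_n) : R :=
  Num.sqrt (\sum_(i < n) x i ord0 ^+ 2).

Definition partial (R : realType) (n : nat) (j : 'I_n) (f : 'cV[R]_n -> R) :
    'cV[R]_n -> R :=
  fun x => 'D_(delta_mx j ord0) f x.

Fixpoint iter_partial (R : realType) (n : nat) (js : seq 'I_n)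
    (f : 'cV[R]_n -> R) : 'cV[R]_n -> R :=
  if js is j :: js' then partial j (iter_partial js' f) else f.

(* 'D_v f x is a total operator, hence the explicit derivability clause. *)
Definition smooth (R : realType) (n : nat) (f : 'cV[R]_n -> R) : Prop :=
  forall js : seq 'I_n,
    continuous (iter_partial js f) /\
    forall (j : 'I_n) (x : 'cV[R]_n),
      derivable (iter_partial js f) x (delta_mx j ord0).

Definition schwartz (R : realType) (n : nat) (f : 'cV[R]_n -> R) : Prop :=
  smooth f /\
  forall (alpha : 'I_n -> nat) (js : seq 'I_n), exists C : R,
    forall x : 'cV[R]_n,
      `|\prod_(i < n) x i ord0 ^+ alpha i * iter_partial js f x| <= C.

Definition Ah (R : realType) (n k : nat) : 'M[R]_n :=
  diag_mx (\row_(j < n) (if (j < k)%N then 1 else -1)).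

(* (X, Xi) solves the bicharacteristic system of A on the open set I of
   times, with data (x0, xi0) at time 0. Values outside I are irrelevant. *)
Definition bicharacteristic (R : realType) (n : nat) (A : 'cV[R]_n -> 'M[R]_n)
    (x0 xi0 : 'cV[R]_n) (I : set R) (X Xi : R -> 'cV[R]_n) : Prop :=
  [/\ X 0 = x0, Xi 0 = xi0 &
      forall s : R, I s -> forall j : 'I_n,
        is_derive s 1 (fun t => X t j ord0)
          (2 * \sum_(k < n) A (X s) j k * Xi s k ord0) /\
        is_derive s 1 (fun t => Xi t j ord0)
          (- \sum_(k < n) \sum_(l < n)
               partial j (fun x => A x k l) (X s) * Xi s k ord0 * Xi s l ord0)].

(* For smooth A solutions are unique, so quantifying over an interval of
   existence ]-delta, delta[ and a solution on it is the same as referring to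
   the flow on its largest such interval. *)
Definition nontrapping (R : realType) (n : nat) (A : 'cV[R]_n -> 'M[R]_n) :
    Prop :=
  forall (x0 xi0 : 'cV[R]_n) (mu : R), xi0 != 0 -> 0 < mu ->
    exists (delta : R) (X Xi : R -> 'cV[R]_n),
      [/\ 0 < delta,
          bicharacteristic A x0 xi0 [set s | - delta < s < delta] X Xi &
          exists2 s0 : R, 0 < s0 < delta & mu <= enorm (X s0)].

(* A^rho for 1 < rho <= +oo; the value at -oo is never used. *)
Definition truncated (R : realType) (n : nat) (theta : 'cV[R]_n -> R)
    (A : 'cV[R]_n -> 'M[R]_n) (A0 : 'M[R]_n) (rho : \bar R) :
    'cV[R]_n -> 'M[R]_n :=
  fun x => if rho is r%:E then
             theta (r^-1 *: x) *: A x + (1 - theta (r^-1 *: x)) *: A0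
           else A x.

Definition outgoing (R : realType) (n : nat) (M1 : R) (X : R -> 'cV[R]_n)
    (s : R) : Prop :=
  0 <= derive1 (fun t => enorm (X t) ^+ 2) s /\ M1 <= enorm (X s).

(* Main.v *)
Require Import Defs.
From mathcomp Require Import ring lra.

Set Implicit Arguments.
Unset Strict Implicit.
Unset Printing Implicit Defensive.

Local Open Scope classical_set_scope.
Local Open Scope ring_scope.

(** Along a bicharacteristic write h = |X|^2 and v = |Xi|^2.  The Hamiltonian
    <A Xi, Xi> is indefinite, so its conservation does not control v; the
    control comes from the decay of A - A_h and from non-trapping.

    Far field.  One has h' = 4 <X, A Xi> and h'' = 8 |A Xi|^2 plus terms bounded
    by C v / |X|, while |v'| <= C v^(3/2) / h, because |A - A_h| and |dA| are at
    most C / |X|^2.  Outside a ball of radius M, which depends on C and n only,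
    h is therefore convex, h'' >= 4 v.  If h' >= 0 at a time when |X| >= M, then
    h grows at least like v(0) t^2 / 2, the majorant v^(3/2) / h of v' has a
    small integral, and v stays between v(0) / 2 and 3 v(0) / 2 (escape,
    flow_escape).  The flow is reversible under (X(-s), - Xi(-s)), so the same
    estimate describes, backwards, an incoming curve up to the time tau at which
    it becomes outgoing or meets the ball (incoming_phase).  It gives
    h(s) >= (tau - s)^2 / 4 there when |Xi(0)| = 1, hence a bound on tau and on
    the time spent in each dyadic shell.

    Near field.  Inside the ball of radius 2 M < rho the truncated flow is the
    flow of A.  A non-trapped reference curve leaves the ball of radius M in
    finite time; by Gronwall's inequality every curve that starts close to it
    does too, with v bounded above and below until then (exit_near_point).
    Compactness of the set |x| <= M, 1/2 <= |xi|^2 <= 2 makes the exit time and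
    the bounds uniform (uniform_exit).

    The constants are uniform in rho because the derivative of theta(x / rho)
    carries a factor 1 / rho <= 1 (truncated_admissible).  The phases are glued
    in a_priori.  Completeness of the flow follows: with the momenta truncated
    at a large height the Hamilton field is bounded and Lipschitz, so that its
    integral curves are global (ode_global_existence, clamped_flow), and the
    a priori bound on v shows that the truncation is never active
    (complete_flow). *)

(** * One-variable calculus *)

Lemma is_derive_continuous (R : realType) (f : R -> R) (x d : R) :
  is_derive x 1 f d -> {for x, continuous f}.
Proof. by case=> /derivable1_diffP /differentiable_continuous. Qed.

Lemma within_continuous (R : realType) (f : R -> R) (a b : R) :
  (forall s : R, a <= s <= b -> {for s, continuous f}) ->
  {within `[a, b], continuous f}.
Proof.
move=> cf; apply: continuous_in_subspaceT => s; rewrite inE/= in_itv/=.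
exact: cf.
Qed.

Lemma mean_value (R : realType) (f df : R -> R) (a b : R) : a < b ->
  (forall s : R, a <= s <= b -> is_derive s 1 f (df s)) ->
  exists2 c, a < c < b & f b - f a = df c * (b - a).
Proof.
move=> ab dfE; case: (@MVT _ f df a b ab).
- by move=> x; rewrite in_itv/= => /andP[ax xb]; apply: dfE; rewrite !ltW.
- by apply: within_continuous => s /dfE/is_derive_continuous.
- by move=> c; rewrite in_itv/= => cab fE; exists c.
Qed.

Lemma ge0_derive_le (R : realType) (f df : R -> R) (a b : R) : a <= b ->
  (forall s : R, a <= s <= b -> is_derive s 1 f (df s)) ->
  (forall s : R, a <= s <= b -> 0 <= df s) -> f a <= f b.
Proof.
rewrite le_eqVlt => /predU1P[->//|ab] dfE df0.
have [c /andP[ac cb] fE] := mean_value ab dfE.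
rewrite -subr_ge0 fE mulr_ge0 ?subr_ge0 ?(ltW ab)//.
by apply: df0; rewrite !ltW.
Qed.

(** The increment of f is dominated by that of p when |f'| <= p'. *)
Lemma derive_le_increment (R : realType) (f df p dp : R -> R) (a b : R) :
  a <= b ->
  (forall s : R, a <= s <= b -> is_derive s 1 f (df s)) ->
  (forall s : R, a <= s <= b -> is_derive s 1 p (dp s)) ->
  (forall s : R, a <= s <= b -> `|df s| <= dp s) -> `|f b - f a| <= p b - p a.
Proof.
move=> ab dfE dpE le_dfp; rewrite ler_norml; apply/andP; split.
- have : f a + p a <= f b + p b.
    apply: (@ge0_derive_le _ (fun s => f s + p s) (fun s => df s + dp s)) => // s sab.
      by have := dfE _ sab; have := dpE _ sab => ? ?; exact: is_deriveD.
    by have := le_dfp _ sab; rewrite ler_norml => /andP[? ?] /=; lra.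
  lra.
- have : p a - f a <= p b - f b.
    apply: (@ge0_derive_le _ (fun s => p s - f s) (fun s => dp s - df s)) => // s sab.
      by have := dfE _ sab; have := dpE _ sab => ? ?; exact: is_deriveB.
    by have := le_dfp _ sab; rewrite ler_norml => /andP[? ?] /=; lra.
  lra.
Qed.

Lemma continuous_lt_near (R : realType) (f : R -> R) (t c : R) :
  {for t, continuous f} -> f t < c ->
  exists2 e, 0 < e & forall s, `|s - t| < e -> f s < c.
Proof.
move=> cf fc.
have /nbhs_ballP[e /= e0 eP] : nbhs t [set s | f s < c].
  by apply: (cf [set y | y < c]); by apply: open_nbhs_nbhs; split; [exact: open_lt|].
by exists e => // s se; apply: eP; rewrite /ball/= distrC.
Qed.

Lemma continuous_gt_near (R : realType) (f : R -> R) (t c : R) :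
  {for t, continuous f} -> c < f t ->
  exists2 e, 0 < e & forall s, `|s - t| < e -> c < f s.
Proof.
move=> cf fc.
have /nbhs_ballP[e /= e0 eP] : nbhs t [set s | c < f s].
  by apply: (cf [set y | c < y]); by apply: open_nbhs_nbhs; split; [exact: open_gt|].
by exists e => // s se; apply: eP; rewrite /ball/= distrC.
Qed.

Lemma continuous_le_left (R : realType) (f : R -> R) (t c a : R) :
  {for t, continuous f} -> a < t -> (forall s : R, a <= s < t -> f s <= c) ->
  f t <= c.
Proof.
move=> cf at_ fc; rewrite leNgt; apply/negP => cft.
have [e e0 eP] := continuous_gt_near cf cft.
have m0 : 0 < Num.min (e / 2) (t - a) by rewrite lt_min; apply/andP; split; lra.
pose s := t - Num.min (e / 2) (t - a).
have h1 : Num.min (e / 2) (t - a) <= e / 2 by rewrite ge_min lexx.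
have h2 : Num.min (e / 2) (t - a) <= t - a by rewrite ge_min lexx orbT.
have := eP s; rewrite /s.
have -> : t - Num.min (e / 2) (t - a) - t = - Num.min (e / 2) (t - a) by ring.
rewrite normrN gtr0_norm// => /(_ ltac:(lra)).
have /fc : a <= s < t by rewrite /s; lra.
by rewrite /s; lra.
Qed.

Lemma continuous_ge_left (R : realType) (f : R -> R) (t c a : R) :
  {for t, continuous f} -> a < t -> (forall s : R, a <= s < t -> c <= f s) ->
  c <= f t.
Proof.
move=> cf at_ fc; rewrite -lerN2; apply: (@continuous_le_left _ (- f) t (- c) a).
- exact: continuousN.
- exact: at_.
- by move=> s /fc; rewrite lerN2.
Qed.

(** A property of times that persists near each time where it holds either
    holds on all of [0, T] or has a first failure. *)
Lemma first_failure (R : realType) (W : R -> Prop) (T : R) :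
  (forall t : R, 0 <= t <= T -> W t ->
     exists2 e, 0 < e & forall s, `|s - t| < e -> W s) ->
  (forall t : R, 0 <= t <= T -> W t) \/
  exists t : R, [/\ 0 <= t <= T, ~ W t & forall s, 0 <= s < t -> W s].
Proof.
move=> openW.
case: (pselect (forall t : R, 0 <= t <= T -> W t)) => [allW|]; first by left.
move=> /existsNP[u /not_implyP[uT NWu]].
right; pose F := [set s | 0 <= s <= T /\ ~ W s].
have F0 : F !=set0 by exists u.
have lbF : lbound F 0 by move=> s [/andP[]].
have hF : has_inf F by split; [exact: F0|exists 0].
have t0 : 0 <= inf F by apply: lb_le_inf.
have tT : inf F <= T.
  apply: (@le_trans _ _ u); last by case/andP: uT.
  by apply: ge_inf => //; case: hF.
have before s : 0 <= s < inf F -> W s.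
  move=> /andP[s0 st]; apply: contrapT => NWs.
  have : inf F <= s.
    by apply: ge_inf; [case: hF|split => //; rewrite s0/=; lra].
  lra.
exists (inf F); split => //; first by rewrite t0 tT.
move=> Wt; have [|e e0 eW] := openW _ _ Wt; first by rewrite t0 tT.
have [s [sT NWs] se] := inf_adherent e0 hF.
have ts : inf F <= s by apply: ge_inf; [case: hF|split].
by apply: NWs; apply: eW; rewrite ger0_norm ?subr_ge0//; lra.
Qed.

(** * The escape estimate *)

Section derivation_rules.
Variable R : realType.
Implicit Types (f g : R -> R) (x a b c : R).

Lemma is_derive_add f g x a b : is_derive x 1 f a -> is_derive x 1 g b ->
  is_derive x 1 (fun s => f s + g s) (a + b).
Proof. by move=> *; apply: is_deriveD. Qed.

Lemma is_derive_sub f g x a b : is_derive x 1 f a -> is_derive x 1 g b ->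
  is_derive x 1 (fun s => f s - g s) (a - b).
Proof. by move=> *; apply: is_deriveB. Qed.

Lemma is_derive_opp f x a : is_derive x 1 f a ->
  is_derive x 1 (fun s => - f s) (- a).
Proof. by move=> *; apply: is_deriveN. Qed.

Lemma is_derive_mul f g x a b : is_derive x 1 f a -> is_derive x 1 g b ->
  is_derive x 1 (fun s => f s * g s) (f x * b + g x * a).
Proof. by move=> *; apply: is_deriveM. Qed.

Lemma is_derive_const x c : is_derive x 1 (fun=> c) 0.
Proof. exact: is_derive_cst. Qed.

Lemma is_derive_scale f x a c : is_derive x 1 f a ->
  is_derive x 1 (fun s => c * f s) (c * a).
Proof.
move=> fa; apply: is_derive_eq (is_derive_mul (is_derive_const x c) fa) _.
by rewrite mulr0 addr0.
Qed.

Lemma is_derive_sqr f x a : is_derive x 1 f a ->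
  is_derive x 1 (fun s => f s ^+ 2) (2 * f x * a).
Proof.
move=> fa; under eq_fun do rewrite expr2.
by apply: is_derive_eq (is_derive_mul fa fa) _; ring.
Qed.

Lemma is_derive_inv f x a : f x != 0 -> is_derive x 1 f a ->
  is_derive x 1 (fun s => (f s)^-1) (- (f x ^+ 2)^-1 * a).
Proof.
move=> fx0 [fd fa]; apply: DeriveDef; first exact: derivableV.
by rewrite deriveV// fa -exprVn exprVn.
Qed.

Lemma is_derive_idfun x : is_derive x 1 (fun s : R => s) 1.
Proof. exact: is_derive_id. Qed.

(** Chain rule for an affine change of time. *)
Lemma is_derive_affine f x a b c : is_derive (c + b * x) 1 f a ->
  is_derive x 1 (fun s => f (c + b * s)) (b * a).
Proof.
move=> fa.
have ha : is_derive x 1 (fun s => c + b * s) b.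
  apply: is_derive_eq (is_derive_add (is_derive_const x c)
    (is_derive_scale b (is_derive_idfun x))) _.
  by rewrite add0r mulr1.
rewrite mulrC; exact: (@is_derive1_comp _ f (fun s => c + b * s) x a b fa ha).
Qed.

Lemma is_derive_translate f x a c : is_derive (c + x) 1 f a ->
  is_derive x 1 (fun s => f (c + s)) a.
Proof.
move=> fa; have -> : (fun s => f (c + s)) = (fun s => f (c + 1 * s)).
  by apply/funext => s; rewrite mul1r.
by apply: is_derive_eq; [apply: is_derive_affine; rewrite mul1r; exact: fa|ring].
Qed.

Lemma is_derive_reverse f x a c : is_derive (c - x) 1 f a ->
  is_derive x 1 (fun s => f (c - s)) (- a).
Proof.
move=> fa; have -> : (fun s => f (c - s)) = (fun s => f (c + -1 * s)).
  by apply/funext => s; rewrite mulN1r.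
by apply: is_derive_eq; [apply: is_derive_affine; rewrite mulN1r; exact: fa|ring].
Qed.

Lemma is_derive_bigsum (I : Type) (r : seq I) (F dF : I -> R -> R) x :
  (forall i, is_derive x 1 (F i) (dF i x)) ->
  is_derive x 1 (fun s => \sum_(i <- r) F i s) (\sum_(i <- r) dF i x).
Proof.
move=> Fd; elim: r => [|i r IH].
  by rewrite big_nil; under eq_fun do rewrite big_nil; exact: is_derive_const.
rewrite big_cons; under eq_fun do rewrite big_cons.
exact: is_derive_add.
Qed.

End derivation_rules.

Section escape.
Variable R : realType.

(** Escape estimate.  Here h stands for |X|^2, g for its derivative and v for
    |Xi|^2: outside the ball of radius N the function h is uniformly convex
    relative to v, while v varies slowly.  A trajectory that is outgoing at
    distance at least M > N then escapes quadratically and keeps v comparable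
    to its initial value. *)
Lemma escape (h g v w u : R -> R) (T N M K : R) :
  0 < N < M -> 0 <= K -> 64 * K <= M ->
  (forall s : R, 0 <= s <= T -> is_derive s 1 h (g s)) ->
  (forall s : R, 0 <= s <= T -> is_derive s 1 g (w s)) ->
  (forall s : R, 0 <= s <= T -> is_derive s 1 v (u s)) ->
  (forall s : R, 0 <= s <= T -> N ^+ 2 <= h s -> 4 * v s <= w s) ->
  (forall s : R, 0 <= s <= T -> N ^+ 2 <= h s ->
     `|u s| <= K / h s * (v s * Num.sqrt (v s))) ->
  M ^+ 2 <= h 0 -> 0 <= g 0 -> 0 < v 0 ->
  forall t : R, 0 <= t <= T ->
    h 0 + v 0 / 2 * t ^+ 2 <= h t /\ v 0 / 2 <= v t <= 3 / 2 * v 0.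
Proof.
move=> /andP[N0 NM] K0 KM dh dg dv hw hu h0 g0 v0.
pose o := Num.sqrt (v 0).
have o0 : 0 < o by rewrite sqrtr_gt0.
have oE : v 0 = o ^+ 2 by rewrite sqr_sqrtr// ltW.
have M0 : 0 < M by lra.
pose weak s := N ^+ 2 <= h s /\ o ^+ 2 / 4 <= v s <= 4 * o ^+ 2.
have core t : 0 <= t <= T -> (forall s, 0 <= s <= t -> weak s) ->
    h 0 + v 0 / 2 * t ^+ 2 <= h t /\ v 0 / 2 <= v t <= 3 / 2 * v 0.
  move=> /andP[t0 tT] wk.
  have inT s : 0 <= s <= t -> 0 <= s <= T.
    by move=> /andP[s0 st]; rewrite s0 (le_trans st).
  have gs s : 0 <= s <= t -> o ^+ 2 * s <= g s.
    move=> /andP[s0 st].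
    have := @ge0_derive_le _ (fun s => g s - o ^+ 2 * s)
      (fun s => w s - o ^+ 2 * 1) 0 s s0.
    have -> : g 0 - o ^+ 2 * 0 = g 0 by ring.
    suff H : g 0 <= g s - o ^+ 2 * s by move=> _; lra.
    have -> : g 0 = g 0 - o ^+ 2 * 0 by ring.
    apply: (@ge0_derive_le _ (fun s => g s - o ^+ 2 * s)
      (fun s => w s - o ^+ 2 * 1)) => // r /andP[r0 rs].
      have rt : 0 <= r <= t by lra.
      exact: is_derive_sub (dg _ (inT _ rt))
        (is_derive_scale _ (is_derive_idfun r)).
    have rt : 0 <= r <= t by lra.
    have [Nr /andP[vr _]] := wk _ rt.
    by have := hw _ (inT _ rt) Nr; lra.
  have hs s : 0 <= s <= t -> h 0 + o ^+ 2 / 2 * s ^+ 2 <= h s.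
    move=> /andP[s0 st].
    suff H : h 0 <= h s - o ^+ 2 / 2 * s ^+ 2 by lra.
    have -> : h 0 = h 0 - o ^+ 2 / 2 * 0 ^+ 2 by ring.
    apply: (@ge0_derive_le _ (fun s => h s - o ^+ 2 / 2 * s ^+ 2)
      (fun s => g s - o ^+ 2 / 2 * (2 * s * 1))) => // r /andP[r0 rs].
      have rt : 0 <= r <= t by lra.
      exact: is_derive_sub (dh _ (inT _ rt))
        (is_derive_scale _ (is_derive_sqr (is_derive_idfun r))).
    have rt : 0 <= r <= t by lra.
    by have := gs _ rt; lra.
  split; first by rewrite oE; apply: hs; rewrite t0 lexx.
  (* primitive of the rational majorant of K |Xi|^3 / |X|^2 *)
  pose q s := M + o / 2 * s.
  have q0 s : 0 <= s -> M <= q s.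
    by move=> s0; rewrite /q lerDl mulr_ge0// ltW// divr_gt0.
  pose p (s : R) := - (32 * K * o ^+ 2) * (q s)^-1.
  pose dp (s : R) := - (32 * K * o ^+ 2) * (- (q s ^+ 2)^-1 * (0 + o / 2 * 1)).
  have dpE s : 0 <= s <= t -> is_derive s 1 p (dp s).
    move=> /andP[s0 st].
    have qs0 : q s != 0 by apply: lt0r_neq0; apply: lt_le_trans (q0 _ s0).
    exact: is_derive_scale _ (is_derive_inv qs0 (is_derive_add
        (is_derive_const s M) (is_derive_scale _ (is_derive_idfun s)))).
  have udp s : 0 <= s <= t -> `|u s| <= dp s.
      move=> st; have [Ns /andP[vs1 vs2]] := wk _ st.
      apply: le_trans (hu _ (inT _ st) Ns) _.
      have s0 : 0 <= s by case/andP: st.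
      have qs0 : 0 < q s by apply: lt_le_trans (q0 _ s0).
      have qq0 : 0 < q s ^+ 2 by rewrite exprn_gt0.
      have hq : q s ^+ 2 <= 2 * h s.
        have : 0 <= (M - o / 2 * s) ^+ 2 by rewrite sqr_ge0.
        have := hs _ st; have : 0 <= (o * s) ^+ 2 by rewrite sqr_ge0.
        rewrite /q !exprMn !sqrrD !exprMn.
        by lra.
      have hs0 : 0 < h s by lra.
      have hV : (h s)^-1 <= 2 * (q s ^+ 2)^-1.
        rewrite -[leLHS]mul1r ler_pdivrMr// mulrAC ler_pdivlMr// mul1r.
        by move: hq; clear; lra.
      have sq : Num.sqrt (v s) <= 2 * o.
        rewrite -[2 * o]ger0_norm; last by lra.
        by rewrite -sqrtr_sqr ler_wsqrtr// exprMn; move: vs2; clear; lra.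
      have : v s * Num.sqrt (v s) <= 4 * o ^+ 2 * (2 * o).
        by apply: ler_pM => //; move: vs1 (sqr_ge0 o); clear; lra.
      set y := _ * Num.sqrt _ => yo.
      have y0 : 0 <= y by rewrite mulr_ge0 ?sqrtr_ge0//; move: vs1 (sqr_ge0 o);
        clear; lra.
      apply: (@le_trans _ _ (K * (2 * (q s ^+ 2)^-1) * (4 * o ^+ 2 * (2 * o)))).
        apply: ler_pM => //; first by rewrite mulr_ge0// invr_ge0 ltW.
        by rewrite ler_wpM2l.
      by rewrite /dp; clear; lra.
  have dv0 := derive_le_increment t0 (fun s st => dv s (inT s st)) dpE udp.
  have qt0 : 0 < q t by apply: lt_le_trans (q0 _ t0).
  have qV : 0 <= 32 * K * o ^+ 2 * (q t)^-1.
    apply: mulr_ge0; last by rewrite invr_ge0 ltW.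
    by apply: mulr_ge0; [lra|exact: sqr_ge0].
  have q0E : 32 * K * o ^+ 2 * (q 0)^-1 <= o ^+ 2 / 2.
    rewrite /q mulr0 addr0 ler_pdivrMr//.
    have := sqr_ge0 o => oo; have : 0 <= o ^+ 2 * (M - 64 * K).
      by rewrite mulr_ge0// subr_ge0.
    lra.
  have : `|v t - v 0| <= o ^+ 2 / 2 by move: dv0 qV q0E; rewrite /p; clear; lra.
  by rewrite ler_norml oE; clear => /andP[? ?]; lra.
pose strict s := N ^+ 2 < h s /\ o ^+ 2 / 4 < v s < 4 * o ^+ 2.
have weakened s : strict s -> weak s.
  by move=> [? /andP[? ?]]; split; [exact: ltW|rewrite !ltW].
have NM2 : N ^+ 2 < M ^+ 2 by rewrite ltr_pXn2r// nnegrE ltW.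
have oo : 0 < o ^+ 2 by rewrite exprn_gt0.
have [|W|[t [tT Nst before]]] := @first_failure _ strict T.
- move=> t tT [h1 /andP[v1 v2]].
  have ch := is_derive_continuous (dh _ tT).
  have cv := is_derive_continuous (dv _ tT).
  have [e1 e10 P1] := continuous_gt_near ch h1.
  have [e2 e20 P2] := continuous_gt_near cv v1.
  have [e3 e30 P3] := continuous_lt_near cv v2.
  exists (Num.min e1 (Num.min e2 e3)); first by rewrite !lt_min e10 e20.
  move=> s; rewrite !lt_min => /and3P[s1 s2 s3]; split; first exact: P1.
  by rewrite P2 ?P3.
- move=> t tT; apply: core => // s /andP[s0 st]; apply: weakened; apply: W.
  by rewrite s0 (le_trans st)//; case/andP: tT.
exfalso; apply: Nst.
have [t0 tT'] := andP tT.
have weak0 : weak 0.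
  by split; [apply/ltW/(lt_le_trans NM2)|rewrite oE; lra].
have weakt s : 0 <= s <= t -> weak s.
  move=> /andP[s0]; rewrite le_eqVlt => /predU1P[->|st]; last first.
    by apply: weakened; apply: before; rewrite s0.
  move: t0; rewrite le_eqVlt => /predU1P[<-//|t0].
  split; [|apply/andP; split].
  - apply: (continuous_ge_left (is_derive_continuous (dh _ tT)) t0).
    by move=> r /before[/ltW].
  - apply: (continuous_ge_left (is_derive_continuous (dv _ tT)) t0).
    by move=> r /before[_ /andP[/ltW]].
  - apply: (continuous_le_left (is_derive_continuous (dv _ tT)) t0).
    by move=> r /before[_ /andP[_ /ltW]].
have [h1 /andP[v1 v2]] := core _ tT weakt.
have : 0 <= v 0 / 2 * t ^+ 2 by rewrite mulr_ge0 ?sqr_ge0// divr_ge0// ltW.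
move=> p0; split; first by move: p0 h1 h0 NM2; clear; lra.
by move: v1 v2 oo; rewrite oE; clear => ? ? ?; apply/andP; split; lra.
Qed.

End escape.

(** * Global existence for ordinary differential equations *)

Section antiderivative.
Variable R : realType.

Let prim (f : R -> R) (a t : R) : R :=
  (\int[lebesgue_measure]_(x in [set` `[a, t]]) f x)%R.

Let is_derive_prim (f : R -> R) (a t : R) : continuous f -> a < t ->
  is_derive t 1 (prim f a) (f t).
Proof.
move=> cf at_; have tu : t < t + 1 by lra.
have fi : lebesgue_measure.-integrable `[a, t + 1] (EFin \o f).
  apply: continuous_compact_integrable; first exact: segment_compact.
  by apply: continuous_subspaceT => x; exact: cf.
have := continuous_FTC1_closed tu fi at_ (cf t).
by rewrite -/(prim f a) derive1E => -[dF F']; exact: DeriveDef dF F'.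
Qed.

Lemma antiderivative (f : R -> R) : continuous f ->
  exists2 g : R -> R, g 0 = 0 & forall t : R, is_derive t 1 g (f t).
Proof.
move=> cf.
(* The base point lies to the left of both 0 and t; the value does not depend
   on it, since two primitives differ by a constant. *)
pose g (t : R) := prim f (- (`|t| + 1)) t - prim f (- (`|t| + 1)) 0.
exists g; first by rewrite /g subrr.
move=> t0; pose A := `|t0| + 2.
have gE (t : R) : `|t - t0| < 1 -> g t = prim f (- A) t - prim f (- A) 0.
  move=> tt0; set b := - (`|t| + 1).
  have Ab : - A <= b.
    rewrite lerN2 /A; have := ler_normD (t - t0) t0.
    by rewrite subrK; lra.
  have bt : b < 0 /\ b < t.
    have := ler_norm (- t); rewrite normrN => ?.
    by split; rewrite /b; have := normr_ge0 t; lra.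
  have cst x y : x <= y -> b < x ->
      prim f (- A) y - prim f b y = prim f (- A) x - prim f b x.
    move=> xy bx; apply/eqP; rewrite -subr_eq0 -normr_le0.
    have := @derive_le_increment R (fun s : R => prim f (- A) s - prim f b s)
       (fun s : R => f s - f s) (fun=> 0) (fun=> 0) x y xy.
    rewrite subrr; apply.
    - move=> s /andP[xs _]; have bs := lt_le_trans bx xs.
      exact: is_derive_sub (is_derive_prim cf (le_lt_trans Ab bs))
        (is_derive_prim cf bs).
    - by move=> s _; rewrite subrr normr0.
  rewrite /g -/b; have [t0'|t0'] := leP 0 t.
    by move: (cst _ _ t0' bt.1); clear; lra.
  by move: (cst _ _ (ltW t0') bt.2); clear; lra.
apply: (@near_eq_is_derive _ _ _ (fun t : R => prim f (- A) t - prim f (- A) 0)).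
- near=> t; apply/esym/gE; rewrite distrC.
  by near: t; apply: (@nbhsx_ballx _ _ t0 1).
- have At0 : - A < t0.
    by rewrite /A; have := ler_norm (- t0); rewrite normrN; lra.
  rewrite -[f t0]subr0.
  exact: is_derive_sub (is_derive_prim cf At0) (is_derive_const _ _).
Unshelve. all: by end_near. Qed.

End antiderivative.

Section sequences_of_reals.
Variable R : realType.

Lemma ler_geometric_error (a b c : R) :
  (forall k : nat, a <= b + c / 2 ^+ k) -> a <= b.
Proof.
move=> H; rewrite leNgt; apply/negP => ba.
have d0 : 0 < a - b by rewrite subr_gt0.
pose k := Num.trunc (`|c| / (a - b)).
have kP : `|c| / (a - b) < k.+1%:R.
  by apply: truncnS_gt; rewrite divr_ge0// ltW.
have k2 : k.+1%:R <= 2 ^+ k.+1 :> R by rewrite -natrX ler_nat ltnW// ltn_expl.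
have p0 : 0 < 2 ^+ k.+1 :> R by rewrite exprn_gt0.
have := H k.+1; have : c / 2 ^+ k.+1 < a - b.
  rewrite ltr_pdivrMr//; apply: le_lt_trans (ler_norm c) _.
  have := lt_le_trans kP k2; rewrite ltr_pdivrMr// mulrC; lra.
lra.
Qed.

(** A sequence with geometrically small increments has a limit, with an
    explicit rate. *)
Lemma geometric_limit (x : nat -> R) (c : R) :
  (forall k, `|x k.+1 - x k| <= c / 2 ^+ k) ->
  exists l, forall k, `|l - x k| <= 2 * c / 2 ^+ k.
Proof.
move=> xc.
have halve k : c / 2 ^+ k = 2 * (c / 2 ^+ k.+1).
  by rewrite exprS invfM; field; rewrite expf_neq0//; apply/lt0r_neq0; lra.
have mono k m : (k <= m)%N ->
    x k - 2 * (c / 2 ^+ k) <= x m - 2 * (c / 2 ^+ m) /\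
    x m + 2 * (c / 2 ^+ m) <= x k + 2 * (c / 2 ^+ k).
  move=> /subnK<-; elim: (m - k)%N => [//|d [IH1 IH2]].
  rewrite addSn; have := xc (d + k)%N; have := halve (d + k)%N.
  rewrite ler_norml => ? /andP[? ?]; lra.
have c0 : 0 <= c.
  by have := xc 0%N; rewrite expr0 divr1; exact: le_trans.
have lohi k m : x k - 2 * (c / 2 ^+ k) <= x m + 2 * (c / 2 ^+ m).
  have pos j : 0 <= c / 2 ^+ j by rewrite divr_ge0// exprn_ge0.
  have := pos k; have := pos m.
  by case: (leqP k m) => [|/ltnW] /mono[]; lra.
pose E := [set y | exists k, y = x k - 2 * (c / 2 ^+ k)].
have hE : has_sup E.
  split; first by exists (x 0%N - 2 * (c / 2 ^+ 0)); exists 0%N.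
  by exists (x 0%N + 2 * (c / 2 ^+ 0)) => _ [k ->]; exact: lohi.
exists (sup E) => k; rewrite -mulrA ler_norml; apply/andP; split.
  have : x k - 2 * (c / 2 ^+ k) <= sup E.
    by apply: sup_upper_bound => //; exists k.
  lra.
have : sup E <= x k + 2 * (c / 2 ^+ k).
  by apply: ge_sup; [case: hE|move=> _ [m ->]; exact: lohi].
lra.
Qed.

End sequences_of_reals.

Section ode.
Variables (R : realType) (I : finType).
Implicit Types (F : (I -> R) -> I -> R) (z w : I -> R) (u : R -> I -> R).

(** F is L-Lipschitz for the sup norm. *)
Definition sup_lipschitz F (L : R) := forall z w d,
  (forall i, `|z i - w i| <= d) -> forall j, `|F z j - F w j| <= L * d.

Lemma sup_lipschitz_continuous F L u : 0 <= L -> sup_lipschitz F L ->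
  (forall i, continuous (fun t => u t i)) ->
  forall i, continuous (fun t => F (u t) i).
Proof.
move=> L0 FL uc i t; apply/cvgrPdist_le => e e0.
have eL : 0 < e / (L + 1) by rewrite divr_gt0//; lra.
have : \forall s \near t, forall j, `|u t j - u s j| <= e / (L + 1).
  apply: (@filter_forall _ _ (fun j s => `|u t j - u s j| <= e / (L + 1)) (nbhs t)) => j.
  by have /cvgrPdist_le := uc j t; exact.
apply: filterS => s /FL /(_ i) /le_trans; apply.
have L1 : 0 < L + 1 by lra.
rewrite mulrA ler_pdivrMr// [L * e]mulrC; apply: ler_wpM2l; first exact: ltW.
by rewrite lerDl.
Qed.

(** Antiderivatives contract by 1 / K in the weight e^(K |t|). *)
Lemma exp_increment (f df : R -> R) (a K t : R) : 0 < K -> 0 <= a -> f 0 = 0 ->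
  (forall s : R, is_derive s 1 f (df s)) ->
  (forall s, `|df s| <= a * expR (K * `|s|)) ->
  `|f t| <= a / K * expR (K * `|t|).
Proof.
move=> K0 a0 f0 fd dfb.
have main (h dh : R -> R) (r : R) : 0 <= r -> h 0 = 0 ->
    (forall s : R, is_derive s 1 h (dh s)) ->
    (forall s, `|dh s| <= a * expR (K * `|s|)) ->
    `|h r| <= a / K * expR (K * `|r|).
  move=> r0 h0 hd dhb; rewrite -[h r]subr0 -h0.
  pose p (s : R) := a / K * expR (0 + K * s).
  have pd (s : R) : is_derive s 1 p (a / K * (K * expR (0 + K * s))).
    exact: is_derive_scale _ (is_derive_affine (is_derive_expR _)).
  have := @derive_le_increment R h dh p _ 0 r r0 (fun s _ => hd s)
    (fun s _ => pd s).
  rewrite /p add0r mulr0 addr0 expR0 (ger0_norm r0) => H.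
  apply: le_trans (H _) _.
    move=> s /andP[s0 _]; have := dhb s; rewrite (ger0_norm s0) add0r.
    by rewrite mulrA divfK// lt0r_neq0.
  by rewrite gerBl mulr1 divr_ge0// ltW.
have [t0|t0] := leP 0 t; first exact: main fd dfb.
have -> : f t = f (0 - - t) by rewrite opprK add0r.
rewrite -(normrN t); apply: (main (fun s => f (0 - s)) (fun s => - df (0 - s))).
- by lra.
- by rewrite subrr.
- by move=> s; exact: is_derive_reverse (fd _).
- by move=> s; rewrite normrN sub0r; have := dfb (- s); rewrite normrN.
Qed.

(** Global existence for a bounded Lipschitz vector field, by Picard iteration
    in the weighted norm sup_t |u t| e^(-2 L |t|). *)
Theorem ode_global_existence F (L B : R) z0 :
  0 <= B -> sup_lipschitz F L -> (forall z i, `|F z i| <= B) ->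
  exists2 u, u 0 = z0 &
    forall (t : R) i, is_derive t 1 (fun s => u s i) (F (u t) i).
Proof.
wlog L1 : L / 1 <= L.
  move=> H B0 FL; apply: (H (Num.max 1 L)); rewrite ?le_max ?lexx//.
  move=> z w d zw j; apply: le_trans (FL z w d zw j) _.
  have d0 : 0 <= d by exact: le_trans (normr_ge0 _) (zw j).
  by rewrite ler_wpM2r// le_max lexx orbT.
move=> B0 FL FB; have L0 : 0 <= L by lra.
have [P PE] : {P : (R -> R) -> R -> R | forall f, continuous f ->
    P f 0 = 0 /\ forall t : R, is_derive t 1 (P f) (f t)}.
  apply/cid.
  have H f : exists g : R -> R, continuous f ->
      g 0 = 0 /\ forall t : R, is_derive t 1 g (f t).
    case: (pselect (continuous f)) => [cf|Ncf]; last by exists f.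
    by have [g g0 gd] := antiderivative cf; exists g.
  by exists (fun f => projT1 (cid (H f))) => f; exact: (projT2 (cid (H f))).
pose step u : R -> I -> R := fun t i => z0 i + P (fun s => F (u s) i) t.
have stepd u (t : R) i : (forall i, continuous (fun t => u t i)) ->
    is_derive t 1 (fun s => step u s i) (F (u t) i).
  move=> uc; rewrite -[F _ _]add0r; apply: (is_derive_add (is_derive_const _ _)).
  by apply: (PE _ _).2; exact: sup_lipschitz_continuous FL uc i.
have step0 u i : (forall i, continuous (fun t => u t i)) -> step u 0 i = z0 i.
  move=> uc; rewrite /step (PE _ _).1 ?addr0//.
  exact: sup_lipschitz_continuous FL uc i.
pose U k := iter k step (fun=> z0).
have Uc k i : continuous (fun t => U k t i).
  elim: k i => [i|k IH i] t; first exact: cst_continuous.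
  exact: is_derive_continuous (stepd (U k) t i IH).
pose E (t : R) : R := expR (2 * L * `|t|).
have E1 t : 1 <= E t.
  by rewrite /E; apply: le_trans (expR_ge1Dx _); rewrite lerDl !mulr_ge0//; lra.
(* step halves the weighted distance *)
have contr u1 u2 a : (forall i, continuous (fun t => u1 t i)) ->
    (forall i, continuous (fun t => u2 t i)) -> 0 <= a ->
    (forall t i, `|u1 t i - u2 t i| <= a * E t) ->
    forall t i, `|step u1 t i - step u2 t i| <= a / 2 * E t.
  move=> c1 c2 a0 H t i.
  have := @exp_increment (fun t => step u1 t i - step u2 t i)
    (fun t => F (u1 t) i - F (u2 t) i) (L * a) (2 * L) t.
  have -> : L * a / (2 * L) = a / 2 by field; apply/lt0r_neq0; lra.
  apply.
  - lra.
  - by rewrite mulr_ge0.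
  - by rewrite !step0// subrr.
  - by move=> s; exact: is_derive_sub (stepd _ _ _ c1) (stepd _ _ _ c2).
  - by move=> s; rewrite -mulrA; apply: FL => j; exact: H.
have incr k t i : `|U k.+1 t i - U k t i| <= B * E t / 2 ^+ k.
  elim: k t i => [t i|k IH t i].
    rewrite expr0 divr1 -[leLHS]/(`|step (U 0%N) t i - z0 i|).
    have := @exp_increment (fun t => step (U 0%N) t i - z0 i)
      (fun t => F (U 0%N t) i - 0) (2 * L * B) (2 * L) t.
    have -> : 2 * L * B / (2 * L) = B by field; apply/lt0r_neq0; lra.
    apply.
    - lra.
    - by rewrite !mulr_ge0//; lra.
    - by rewrite step0// subrr.
    - by move=> s; exact: is_derive_sub (stepd _ _ _ (Uc _)) (is_derive_const _ _).
    - move=> s; rewrite subr0; apply: le_trans (FB _ _) _.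
      have LB : 0 <= 2 * L * B by rewrite !mulr_ge0.
      apply: (@le_trans _ _ (2 * L * B)).
        by rewrite -[leLHS]mul1r; apply: ler_wpM2r => //; lra.
      by rewrite -[leLHS]mulr1; apply: ler_wpM2l => //; exact: (E1 s).
  have := @contr (U k.+1) (U k) (B / 2 ^+ k) (Uc _) (Uc _) _ _ t i.
  rewrite exprSr invfM mulrA.
  have -> : B / 2 ^+ k / 2 * E t = B * E t / 2 ^+ k / 2 by ring.
  apply; first by rewrite divr_ge0 ?exprn_ge0.
  by move=> s j; have -> : B / 2 ^+ k * E s = B * E s / 2 ^+ k by ring.
have /choice[u uE] : forall ti : R * I, exists l, forall k,
    `|l - U k ti.1 ti.2| <= 2 * (B * E ti.1) / 2 ^+ k.
  by move=> [t i]; apply: geometric_limit => k; exact: incr.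
pose v t i := u (t, i).
have vE t i k : `|v t i - U k t i| <= 2 * (B * E t) / 2 ^+ k by exact: (uE (t, i)).
have Ulip k t s i : `|U k t i - U k s i| <= B * `|t - s|.
  case: k => [|k]; first by rewrite /U/= subrr normr0 mulr_ge0//.
  wlog st : t s / s <= t.
    move=> H; have [/H//|/ltW/H] := leP s t.
    by rewrite distrC (distrC s).
  have := @derive_le_increment R (fun t => U k.+1 t i) (fun t => F (U k t) i)
    (fun t => B * t) (fun t => B * 1) s t st.
  rewrite -mulrBr (@ger0_norm _ (t - s)) ?subr_ge0//; apply.
  - by move=> r _; exact: stepd.
  - by move=> r _; rewrite mulr1.
(* The iterates are uniformly B-Lipschitz, hence so is their limit v. *)
have vlip t s i : `|v t i - v s i| <= B * `|t - s|.
  apply: (@ler_geometric_error _ _ _ (2 * (B * E t) + 2 * (B * E s))) => k.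
  have -> : v t i - v s i = (v t i - U k t i) + (U k t i - U k s i) -
                            (v s i - U k s i) by ring.
  apply: le_trans (ler_normB _ _) _; apply: le_trans (lerD (ler_normD _ _) (lexx _)) _.
  have := vE t i k; have := vE s i k; have := Ulip k t s i; lra.
have vc i : continuous (fun t => v t i).
  move=> t; apply/cvgrPdist_le => e e0.
  have eB : 0 < e / (B + 1) by rewrite divr_gt0//; lra.
  near=> s; apply: le_trans (vlip _ _ _) _.
  have : `|t - s| <= e / (B + 1).
    by near: s; apply: (@cvgr_dist_le _ _ _ _ _ id t) => //; exact: cvg_id.
  move=> /(ler_wpM2l B0) /le_trans; apply.
  rewrite mulrA ler_pdivrMr; last by lra.
  rewrite [B * e]mulrC; apply: ler_wpM2l; first exact: ltW.
  by rewrite lerDl.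
(* v is a fixed point of step. *)
have stepv t i : step v t i = v t i.
  apply/eqP; rewrite -subr_eq0 -normr_le0.
  apply: (@ler_geometric_error _ _ _ (2 * B * E t)) => k; rewrite add0r.
  have -> : step v t i - v t i = (step v t i - U k.+1 t i) - (v t i - U k.+1 t i).
    by ring.
  apply: le_trans (ler_normB _ _) _.
  have := vE t i k.+1.
  have := @contr v (U k) (2 * B / 2 ^+ k) vc (Uc k) _ _ t i.
  rewrite -[step (U k) t i]/(U k.+1 t i) => /(_ _ _) H.
  have {H} : `|step v t i - U k.+1 t i| <= 2 * B / 2 ^+ k / 2 * E t.
    apply: H; first by rewrite divr_ge0 ?exprn_ge0// mulr_ge0//.
    move=> s j; have -> : 2 * B / 2 ^+ k * E s = 2 * (B * E s) / 2 ^+ k by ring.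
    exact: vE.
  rewrite exprSr invfM.
  lra.
exists v; first by apply/funext => i; rewrite -stepv step0.
move=> t i; have := stepd v t i vc.
by have -> : (fun s => step v s i) = (fun s => v s i) by apply/funext.
Unshelve. all: by end_near. Qed.

End ode.

(** * Mean value formula and chain rule in several variables *)

Section several_variables.
Variables (R : realType) (n : nat).
Implicit Types (f : 'cV[R]_n -> R) (x y v : 'cV[R]_n).

Lemma is_derive_line f x v (t : R) : derivable f (x + t *: v) v ->
  is_derive t 1 (fun s => f (x + s *: v)) ('D_v f (x + t *: v)).
Proof.
move=> fd.
have E : (fun h : R => h^-1 *: (((fun s => f (x + s *: v)) \o shift t) (h *: 1)
     - f (x + t *: v))) =
   (fun h : R => h^-1 *: ((f \o shift (x + t *: v)) (h *: v) - f (x + t *: v))).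
  apply/funext => h /=; congr (_ *: (f _ - _)).
  by rewrite -[h *: 1]/(h * 1) mulr1 scalerDl addrCA.
apply: DeriveDef; first by rewrite /derivable E.
by rewrite /derive E.
Qed.

Lemma mean_value_from0 (g dg : R -> R) (c : R) :
  (forall s : R, is_derive s 1 g (dg s)) ->
  exists2 t, `|t| <= `|c| & g c - g 0 = dg t * c.
Proof.
move=> gd; have [c0|c0|<-] := ltgtP 0 c; last first.
- by exists 0 => //; rewrite subrr mulr0.
- have [t /andP[t1 t2]] := mean_value c0 (fun s _ => gd s).
  rewrite sub0r => E; exists t; first by rewrite !ler0_norm ?(ltW c0)//; lra.
  by rewrite -opprB E mulrN opprK.
- have [t /andP[t1 t2]] := mean_value c0 (fun s _ => gd s).
  by rewrite subr0 => E; exists t => //; rewrite !ger0_norm//; lra.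
Qed.

(** Mean value formula along a broken line parallel to the axes. *)
Lemma partial_mean_value f x y :
  (forall j z, derivable f z (delta_mx j ord0)) ->
  exists2 p : 'I_n -> 'cV[R]_n,
    (forall j i, `|p j i ord0 - x i ord0| <= `|y i ord0 - x i ord0|) &
    f y - f x = \sum_j partial j f (p j) * (y j ord0 - x j ord0).
Proof.
move=> fd.
(* the m-th vertex of the broken line from x to y *)
pose path (m : nat) : 'cV[R]_n :=
  \col_i (if (i < m)%N then y i ord0 else x i ord0).
have /choice[t tE] : forall j : 'I_n, exists t : R,
    `|t| <= `|y j ord0 - x j ord0| /\
    f (path j.+1) - f (path j) =
    partial j f (path j + t *: delta_mx j ord0) * (y j ord0 - x j ord0).
  move=> j; have := @mean_value_from0
    (fun s => f (path j + s *: delta_mx j ord0))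
    (fun s => partial j f (path j + s *: delta_mx j ord0))
    (y j ord0 - x j ord0) (fun s => is_derive_line (fd j _)).
  case=> t tc E; exists t; split => //; rewrite -{}E; congr (f _ - f _).
    apply/colP => i; rewrite !mxE eqxx andbT ltnS leq_eqVlt.
    have [/val_inj->|ij] := eqVneq (i : nat) j.
      by rewrite ltnn eqxx mulr1 addrC subrK.
    by rewrite -val_eqE (negbTE ij) mulr0 addr0.
  by rewrite scale0r addr0.
exists (fun j : 'I_n => path j + t j *: delta_mx j ord0).
  move=> j i; rewrite !mxE eqxx andbT.
  have [->|ij] := eqVneq i j.
    by rewrite ltnn mulr1 addrAC subrr add0r; exact: (tE j).1.
  by rewrite mulr0 addr0; case: ifP => // _; rewrite subrr normr0.
under eq_bigr => j _ do rewrite -(tE j).2.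
have := @telescope_sumr _ 0%N n (fun m => f (path m)) (leq0n n).
rewrite big_mkord => ->; congr (f _ - f _); apply/colP => i; rewrite !mxE//.
by rewrite ltn_ord.
Qed.

(** K-Lipschitz for the sup norm of the coordinates. *)
Definition coord_lipschitz (K : R) f := forall x y d,
  (forall i, `|x i ord0 - y i ord0| <= d) -> `|f x - f y| <= K * d.

Lemma partial_bounded_lipschitz f (C : R) :
  (forall j z, derivable f z (delta_mx j ord0)) ->
  (forall j z, `|partial j f z| <= C) -> coord_lipschitz (n%:R * C) f.
Proof.
move=> fd fC x y d xy; have [p _ ->] := partial_mean_value y x fd.
apply: le_trans (ler_norm_sum _ _ _) _.
apply: (@le_trans _ _ (\sum_(j < n) C * d)).
  by apply: ler_sum => j _; rewrite normrM; apply: ler_pM.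
by rewrite sumr_const card_ord -mulrA mulr_natl.
Qed.

Lemma is_derive_cvg (F : R -> R) (s d : R) :
  (h^-1 *: (F (h + s) - F s)) @[h --> 0^'] --> d -> is_derive s 1 F d.
Proof.
move=> H.
have E : (fun h : R => h^-1 *: ((F \o shift s) (h *: 1) - F s)) =
   (fun h : R => h^-1 *: (F (h + s) - F s)).
  by apply/funext => h /=; rewrite -[h *: 1]/(h * 1) mulr1.
apply: DeriveDef; first by rewrite /derivable E; apply/cvg_ex; exists d.
by rewrite /derive E; apply: cvg_lim.
Qed.

Lemma cvg_is_derive (F : R -> R) (s d : R) : is_derive s 1 F d ->
  (h^-1 *: (F (h + s) - F s)) @[h --> 0^'] --> d.
Proof.
move=> [Fd <-].
have E : (fun h : R => h^-1 *: ((F \o shift s) (h *: 1) - F s)) =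
   (fun h : R => h^-1 *: (F (h + s) - F s)).
  by apply/funext => h /=; rewrite -[h *: 1]/(h * 1) mulr1.
by rewrite -E; exact: Fd.
Qed.

Lemma cvg_bigsum (T J : Type) (G : set_system T) (r : seq J)
    (h : J -> T -> R) (l : J -> R) : Filter G ->
  (forall j, h j t @[t --> G] --> l j) ->
  (\sum_(j <- r) h j t) @[t --> G] --> \sum_(j <- r) l j.
Proof.
move=> FG hl; elim: r => [|j r IH].
  by rewrite big_nil; under eq_fun do rewrite big_nil; exact: cvg_cst.
by rewrite big_cons; under eq_fun do rewrite big_cons; exact: cvgD.
Qed.

(** Chain rule along a curve, for a function with Lipschitz partial
    derivatives. *)
Lemma chain_rule f (K : R) (X dX : R -> 'cV[R]_n) (s : R) :
  (forall j z, derivable f z (delta_mx j ord0)) ->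
  (forall j, coord_lipschitz K (partial j f)) ->
  (forall j, is_derive s 1 (fun t => X t j ord0) (dX s j ord0)) ->
  is_derive s 1 (fun t => f (X t))
    (\sum_j partial j f (X s) * dX s j ord0).
Proof.
move=> fd fK Xd; apply: is_derive_cvg.
have /choice[p pE] : forall h : R, exists p : 'I_n -> 'cV[R]_n,
    (forall j i, `|p j i ord0 - X s i ord0| <= `|X (h + s) i ord0 - X s i ord0|) /\
    f (X (h + s)) - f (X s) =
    \sum_j partial j f (p j) * (X (h + s) j ord0 - X s j ord0).
  by move=> h; have [p ? ?] := partial_mean_value (X s) (X (h + s)) fd; exists p.
have -> : (fun h : R => h^-1 *: (f (X (h + s)) - f (X s))) = (fun h => \sum_j
    partial j f (p h j) * (h^-1 *: (X (h + s) j ord0 - X s j ord0))).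
  apply/funext => h; rewrite (pE h).2 scaler_sumr; apply: eq_bigr => j _.
  by rewrite -[LHS]/(_ * _) -[_ *: _]/(_ * _) mulrCA.
apply: cvg_bigsum => j; apply: cvgM; last exact: cvg_is_derive.
(* the intermediate points tend to X s *)
have Xc : (\sum_i `|X (h + s) i ord0 - X s i ord0|) @[h --> (0 : R)^'] --> (0 : R).
  suff H : (\sum_i `|X (h + s) i ord0 - X s i ord0|) @[h --> (0 : R)] -->
      (\sum_(i < n) 0 : R).
    by rewrite big1_eq in H; exact: cvg_within_filter H.
  apply: cvg_bigsum => i.
  have Xis := is_derive_continuous (Xd i).
  have H0 : X (h + s) i ord0 @[h --> (0 : R)] --> X s i ord0.
    have sh : (h + s) @[h --> (0 : R)] --> s.
      have : (h + s) @[h --> (0 : R)] --> (0 : R) + s.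
        by apply: cvgD; [exact: cvg_id|exact: cvg_cst].
      by rewrite add0r.
    exact: (@cvg_comp _ _ _ (fun h : R => h + s) (fun t => X t i ord0) _
      (nbhs s) _ sh Xis).
  have := cvg_norm (cvgB H0 (cvg_cst (X s i ord0))).
  by rewrite subrr normr0; apply.
apply/cvgrPdist_le => e e0.
have eK : 0 < e / (`|K| + 1) by rewrite divr_gt0// ltr_wpDl.
have /cvgrPdist_le/(_ _ eK) := Xc.
apply: filterS => h; rewrite sub0r normrN ger0_norm ?sumr_ge0// => he.
rewrite distrC; apply: le_trans (fK j _ _ (e / (`|K| + 1)) _) _.
  move=> i; apply: le_trans ((pE h).1 j i) _; apply: le_trans he.
  by rewrite (bigD1 i)//= lerDl sumr_ge0.
have K1 : 0 < `|K| + 1 by rewrite ltr_wpDl.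
rewrite mulrA ler_pdivrMr// [K * e]mulrC; apply: ler_wpM2l; first exact: ltW.
by apply: le_trans (ler_norm K) _; rewrite lerDl.
Qed.

End several_variables.

(** * Bicharacteristics in the far field *)

Section bicharacteristics.
Variables (R : realType) (n : nat).
Implicit Types (a : 'cV[R]_n -> 'M[R]_n) (x xi : 'cV[R]_n).
Implicit Types (X Xi : R -> 'cV[R]_n).

(** Squared Euclidean norm. *)
Definition sqn x : R := \sum_(i < n) x i ord0 ^+ 2.

Lemma sqn_ge0 x : 0 <= sqn x.
Proof. by apply: sumr_ge0 => i _; exact: sqr_ge0. Qed.

Lemma enorm_sqr x : enorm x ^+ 2 = sqn x.
Proof. by rewrite /enorm sqr_sqrtr// sqn_ge0. Qed.

Lemma enorm_ge0 x : 0 <= enorm x.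
Proof. exact: sqrtr_ge0. Qed.

Lemma sqr_coord_le x i : x i ord0 ^+ 2 <= sqn x.
Proof. by rewrite /sqn (bigD1 i)//= lerDl sumr_ge0// => j _; exact: sqr_ge0. Qed.

Lemma coord_le x i : `|x i ord0| <= Num.sqrt (sqn x).
Proof. by rewrite -sqrtr_sqr ler_wsqrtr// sqr_coord_le. Qed.

Lemma sqnN x : sqn (- x) = sqn x.
Proof. by apply: eq_bigr => i _; rewrite mxE sqrrN. Qed.

(** The two halves of the Hamilton field of <a(x) xi, xi>. *)
Definition velX a x xi (j : 'I_n) : R := 2 * \sum_(k < n) a x j k * xi k ord0.

Definition velXi a x xi (j : 'I_n) : R :=
  - \sum_(k < n) \sum_(l < n)
      partial j (fun x => a x k l) x * xi k ord0 * xi l ord0.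

(** (X, Xi) is an integral curve of the Hamilton field at the times in D. *)
Definition flow_in a (D : set R) X Xi := forall s : R, D s -> forall j : 'I_n,
  is_derive s 1 (fun t => X t j ord0) (velX a (X s) (Xi s) j) /\
  is_derive s 1 (fun t => Xi t j ord0) (velXi a (X s) (Xi s) j).

Lemma velX_opp a x xi j : velX a x (- xi) j = - velX a x xi j.
Proof.
rewrite /velX -mulrN -sumrN; congr (_ * _); apply: eq_bigr => k _.
by rewrite mxE mulrN.
Qed.

Lemma velXi_opp a x xi j : velXi a x (- xi) j = velXi a x xi j.
Proof.
rewrite /velXi; congr (- _); apply: eq_bigr => k _; apply: eq_bigr => l _.
by rewrite !mxE !mulrN mulNr opprK.
Qed.

Lemma flow_in_sub a (D D' : set R) X Xi : D' `<=` D ->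
  flow_in a D X Xi -> flow_in a D' X Xi.
Proof. by move=> sub fl s /sub; exact: fl. Qed.

Lemma flow_in_shift a (D : set R) X Xi c : flow_in a D X Xi ->
  flow_in a [set s | D (c + s)] (fun s => X (c + s)) (fun s => Xi (c + s)).
Proof.
move=> fl s Ds j; have [dX dXi] := fl _ Ds j.
by split; [exact: is_derive_translate dX|exact: is_derive_translate dXi].
Qed.

(** Time reversal: (X(c - s), - Xi(c - s)) is again an integral curve. *)
Lemma flow_in_reverse a (D : set R) X Xi c : flow_in a D X Xi ->
  flow_in a [set s | D (c - s)] (fun s => X (c - s)) (fun s => - Xi (c - s)).
Proof.
move=> fl s Ds j; have [dX dXi] := fl _ Ds j; split.
  by rewrite velX_opp; exact: is_derive_reverse dX.
rewrite velXi_opp -[velXi _ _ _ _]opprK.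
under eq_fun do rewrite mxE.
exact: is_derive_opp (is_derive_reverse dXi).
Qed.

(** 4 <x, a(x) xi>: the derivative of |X|^2 along the flow at (x, xi). *)
Definition radial a x xi : R :=
  4 * \sum_(j < n) x j ord0 * \sum_(l < n) a x j l * xi l ord0.

Lemma radial_opp a x xi : radial a x (- xi) = - radial a x xi.
Proof.
rewrite /radial -mulrN -sumrN; congr (_ * _); apply: eq_bigr => j _.
rewrite -mulrN -sumrN; congr (_ * _); apply: eq_bigr => k _.
by rewrite mxE mulrN.
Qed.

Section along_a_flow.
Variables (a : 'cV[R]_n -> 'M[R]_n) (D : set R) (X Xi : R -> 'cV[R]_n).
Hypothesis fl : flow_in a D X Xi.

Lemma is_derive_sqnX (s : R) : D s ->
  is_derive s 1 (fun t => sqn (X t)) (radial a (X s) (Xi s)).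
Proof.
move=> Ds; apply: is_derive_eq (is_derive_bigsum _
  (F := fun j t => X t j ord0 ^+ 2)
  (dF := fun j t => 2 * X t j ord0 * velX a (X t) (Xi t) j) _) _.
  by move=> j; exact: is_derive_sqr (fl Ds j).1.
rewrite /radial mulr_sumr; apply: eq_bigr => j _.
by rewrite /velX; set S := \sum_(_ < _) _; ring.
Qed.

Lemma is_derive_sqnXi (s : R) : D s ->
  is_derive s 1 (fun t => sqn (Xi t))
    (\sum_(j < n) 2 * Xi s j ord0 * velXi a (X s) (Xi s) j).
Proof.
move=> Ds; apply: (is_derive_bigsum _
  (F := fun j t => Xi t j ord0 ^+ 2)
  (dF := fun j t => 2 * Xi t j ord0 * velXi a (X t) (Xi t) j)).
by move=> j; exact: is_derive_sqr (fl Ds j).2.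
Qed.

(** The second derivative of |X|^2 along the flow at (x, xi). *)
Definition radial_rate x xi : R :=
  4 * \sum_(j < n) (x j ord0 * \sum_(l < n)
      (a x j l * velXi a x xi l + xi l ord0 *
       \sum_(m < n) partial m (fun y => a y j l) x * velX a x xi m)
    + (\sum_(l < n) a x j l * xi l ord0) * velX a x xi j).

Lemma is_derive_radial (K : R) (s : R) :
  (forall j l m z, derivable (fun x => a x j l) z (delta_mx m ord0)) ->
  (forall j l m, coord_lipschitz K (partial m (fun x => a x j l))) ->
  D s ->
  is_derive s 1 (fun t => radial a (X t) (Xi t)) (radial_rate (X s) (Xi s)).
Proof.
move=> ad aK Ds; apply: is_derive_scale.
apply: (is_derive_bigsum _
  (F := fun j t => X t j ord0 * \sum_(l < n) a (X t) j l * Xi t l ord0)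
  (dF := fun j t => X t j ord0 * \sum_(l < n)
      (a (X t) j l * velXi a (X t) (Xi t) l + Xi t l ord0 *
       \sum_(m < n) partial m (fun y => a y j l) (X t) * velX a (X t) (Xi t) m)
    + (\sum_(l < n) a (X t) j l * Xi t l ord0) * velX a (X t) (Xi t) j)) => j.
apply: is_derive_mul; first exact: (fl Ds j).1.
apply: (is_derive_bigsum _
  (F := fun l t => a (X t) j l * Xi t l ord0)
  (dF := fun l t => a (X t) j l * velXi a (X t) (Xi t) l + Xi t l ord0 *
    \sum_(m < n) partial m (fun y => a y j l) (X t) * velX a (X t) (Xi t) m)) => l.
apply: is_derive_mul; last exact: (fl Ds l).2.
have := @chain_rule R n (fun y => a y j l) K X
  (fun t => \col_m velX a (X t) (Xi t) m) s (ad j l) (aK j l).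
under eq_bigr do rewrite mxE.
by apply=> m; rewrite mxE; exact: (fl Ds m).1.
Qed.

End along_a_flow.

Section far_field.
Variable k : nat.

(** Quantitative form of the assumptions on a symbol: a and its first
    derivatives are bounded by C, approach their limits like C / |x|^2, and
    are K-Lipschitz.  The far-field estimates depend on C only. *)
Record admissible (C K : R) a : Prop := Admissible {
  adm_C : 0 <= C;
  adm_K : 0 <= K;
  adm_derivable : forall j l m z, derivable (fun x => a x j l) z (delta_mx m ord0);
  adm_bound : forall j l x, `|a x j l| <= C;
  adm_dbound : forall j l m x, `|partial m (fun x => a x j l) x| <= C;
  adm_decay : forall j l x, sqn x * `|a x j l - Ah R n k j l| <= C;
  adm_ddecay : forall j l m x, sqn x * `|partial m (fun x => a x j l) x| <= C;
  adm_lip : forall j l, coord_lipschitz K (fun x => a x j l);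
  adm_dlip : forall j l m, coord_lipschitz K (partial m (fun x => a x j l)) }.

Lemma ler_norm_sum_ord (F : 'I_n -> R) (B : R) :
  (forall i, `|F i| <= B) -> `|\sum_(i < n) F i| <= n%:R * B.
Proof.
move=> FB; apply: le_trans (ler_norm_sum _ _ _) _.
apply: (@le_trans _ _ (\sum_(i < n) B)); first exact: ler_sum.
by rewrite sumr_const card_ord mulr_natl.
Qed.

Variables (C K : R) (a : 'cV[R]_n -> 'M[R]_n).
Hypothesis adm : admissible C K a.

Let C0 := adm_C adm.

(* Beyond the radius N1 the perturbative terms of radial_rate are absorbed by
   its main term 8 |xi|^2. *)
Let N1 : R := 1 + 6 * n%:R ^+ 4 * C ^+ 2 + 8 * n%:R ^+ 2 * C.

Lemma velX_bound x xi j : `|velX a x xi j| <= 2 * (n%:R * (C * Num.sqrt (sqn xi))).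
Proof.
rewrite /velX normrM ger0_norm// ler_wpM2l// ler_norm_sum_ord// => l.
by rewrite normrM ler_pM// ?(adm_bound adm) ?coord_le.
Qed.

Lemma velXi_bound x xi j (B : R) :
  (forall k l, `|partial j (fun x => a x k l) x| <= B) ->
  `|velXi a x xi j| <= n%:R ^+ 2 * B * sqn xi.
Proof.
move=> dB; rewrite /velXi normrN expr2 -!mulrA.
apply: ler_norm_sum_ord => p; apply: ler_norm_sum_ord => l.
rewrite 2!normrM -mulrA; apply: ler_pM => //.
rewrite -[leRHS]sqr_sqrtr ?sqn_ge0// expr2.
by apply: ler_pM => //; exact: coord_le.
Qed.

Lemma sqnXi_rate_bound x xi (B : R) :
  (forall j k l, `|partial j (fun x => a x k l) x| <= B) ->
  `|\sum_(j < n) 2 * xi j ord0 * velXi a x xi j| <=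
  2 * n%:R ^+ 3 * B * (sqn xi * Num.sqrt (sqn xi)).
Proof.
move=> dB; set e := Num.sqrt (sqn xi).
have -> : 2 * n%:R ^+ 3 * B * (sqn xi * e) =
  n%:R * (2 * e * (n%:R ^+ 2 * B * sqn xi)) by ring.
apply: ler_norm_sum_ord => j; rewrite normrM; apply: ler_pM => //.
  by rewrite normrM ger0_norm// ler_wpM2l// coord_le.
exact: velXi_bound.
Qed.

Lemma mul_coord_le (N r t : R) : 0 <= N -> N ^+ 2 <= r -> t ^+ 2 <= r ->
  N * `|t| <= r.
Proof.
move=> N0 Nr tr; have r0 : 0 <= r by apply: le_trans Nr; exact: sqr_ge0.
rewrite -(@ler_pXn2r _ 2)// ?nnegrE ?mulr_ge0//.
rewrite exprMn real_normK ?num_real// [leRHS]expr2.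
by apply: ler_pM => //; exact: sqr_ge0.
Qed.

(** Convexity of |X|^2 in the far field. *)
Lemma far_convex x xi : N1 ^+ 2 <= sqn x -> 4 * sqn xi <= radial_rate a x xi.
Proof.
move=> Nx; pose e := Num.sqrt (sqn xi); pose c : R := n%:R.
have c0 : 0 <= c by rewrite ler0n.
have e0 : 0 <= e by exact: sqrtr_ge0.
have eE : sqn xi = e ^+ 2 by rewrite sqr_sqrtr// sqn_ge0.
have p1 : 0 <= 6 * c ^+ 4 * C ^+ 2 by rewrite !mulr_ge0 ?sqr_ge0 ?exprn_ge0.
have p2 : 0 <= 8 * c ^+ 2 * C by rewrite !mulr_ge0 ?sqr_ge0 ?exprn_ge0.
have N1ge : 1 <= N1 by rewrite /N1 -/c; lra.
have N10 : 0 < N1 by lra.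
have h0 : 0 < sqn x by apply: lt_le_trans Nx; rewrite exprn_gt0.
have N1h : N1 <= sqn x by apply: le_trans Nx; rewrite expr2 ler_peMl// ltW.
have xN j : N1 * `|x j ord0| <= sqn x.
  by apply: mul_coord_le => //; [exact: ltW|exact: sqr_coord_le].
have xiE j : `|xi j ord0| <= e by exact: coord_le.
have dec j l : `|a x j l - Ah R n k j l| <= C / sqn x.
  by rewrite ler_pdivlMr// mulrC (adm_decay adm).
have ddec j l m : `|partial m (fun x => a x j l) x| <= C / sqn x.
  by rewrite ler_pdivlMr// mulrC (adm_ddecay adm).
(* sizes of the two perturbative terms *)
have pert j : `|x j ord0 * \sum_(l < n)
      (a x j l * velXi a x xi l + xi l ord0 *
       \sum_(m < n) partial m (fun y => a y j l) x * velX a x xi m)| <=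
      3 * c ^+ 3 * C ^+ 2 * e ^+ 2 / N1.
  have S : `|\sum_(l < n) (a x j l * velXi a x xi l + xi l ord0 *
       \sum_(m < n) partial m (fun y => a y j l) x * velX a x xi m)| <=
       c * (3 * c ^+ 2 * C ^+ 2 * e ^+ 2 / sqn x).
    apply: ler_norm_sum_ord => l; apply: le_trans (ler_normD _ _) _.
    have -> : 3 * c ^+ 2 * C ^+ 2 * e ^+ 2 / sqn x =
      C * (c ^+ 2 * (C / sqn x) * sqn xi) +
      e * (c * (C / sqn x * (2 * (c * (C * e))))) by rewrite eE; ring.
    apply: lerD; rewrite normrM; apply: ler_pM => //.
    - exact: (adm_bound adm).
    - exact: velXi_bound.
    - apply: ler_norm_sum_ord => m; rewrite normrM; apply: ler_pM => //.
      exact: velX_bound.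
  rewrite normrM; apply: (@le_trans _ _ (sqn x / N1 *
      (c * (3 * c ^+ 2 * C ^+ 2 * e ^+ 2 / sqn x)))).
    by apply: ler_pM => //; rewrite ler_pdivlMr// mulrC.
  rewrite le_eqVlt; apply/orP; left; apply/eqP.
  by field; rewrite !lt0r_neq0.
(* a is close to A_h, which acts on momenta by changes of sign *)
have main j : xi j ord0 ^+ 2 - 2 * e * (c * (C / sqn x * e)) <=
    (\sum_(l < n) a x j l * xi l ord0) ^+ 2.
  have -> : \sum_(l < n) a x j l * xi l ord0 =
     \sum_(l < n) Ah R n k j l * xi l ord0 +
     \sum_(l < n) (a x j l - Ah R n k j l) * xi l ord0.
    by rewrite -big_split; apply: eq_bigr => l _ /=; rewrite -mulrDl addrC subrK.
  set q := \sum_(l < n) (_ - _) * _.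
  have qb : `|q| <= c * (C / sqn x * e).
    by apply: ler_norm_sum_ord => l; rewrite normrM; apply: ler_pM.
  have AhE : \sum_(l < n) Ah R n k j l * xi l ord0 =
      (if (j < k)%N then 1 else -1) * xi j ord0.
    rewrite (bigD1 j)//= big1 ?addr0; last first.
      by move=> l lj; rewrite !mxE eq_sym (negbTE lj) mulr0n mul0r.
    by rewrite !mxE eqxx mulr1n.
  rewrite AhE; set y := xi j ord0.
  set p := _ * y; have pE : p ^+ 2 = y ^+ 2.
    by rewrite /p exprMn; case: ifP => _; rewrite ?sqrrN expr1n mul1r.
  have py : `|p| <= e.
    by rewrite /p normrM; case: ifP => _; rewrite ?normrN normr1 mul1r; exact: xiE.
  have : `|p * q| <= e * (c * (C / sqn x * e)) by rewrite normrM; apply: ler_pM.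
  have := sqr_ge0 q; rewrite sqrrD pE ler_norml => ? /andP[? ?]; lra.
have sum1 : - (c * (3 * c ^+ 3 * C ^+ 2 * e ^+ 2 / N1)) <=
    \sum_(j < n) x j ord0 * \sum_(l < n)
      (a x j l * velXi a x xi l + xi l ord0 *
       \sum_(m < n) partial m (fun y => a y j l) x * velX a x xi m).
  by have := ler_norm_sum_ord pert; rewrite ler_norml => /andP[].
have sum2 : e ^+ 2 - c * (2 * e * (c * (C / sqn x * e))) <=
    \sum_(j < n) (\sum_(l < n) a x j l * xi l ord0) ^+ 2.
  have -> : e ^+ 2 - c * (2 * e * (c * (C / sqn x * e))) =
      \sum_(j < n) (xi j ord0 ^+ 2 - 2 * e * (c * (C / sqn x * e))).
    rewrite sumrB sumr_const card_ord -eE; congr (_ - _).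
    by rewrite /c mulr_natl.
  by apply: ler_sum => j _; exact: main.
have -> : radial_rate a x xi = 4 * \sum_(j < n) x j ord0 * \sum_(l < n)
      (a x j l * velXi a x xi l + xi l ord0 *
       \sum_(m < n) partial m (fun y => a y j l) x * velX a x xi m) +
    8 * \sum_(j < n) (\sum_(l < n) a x j l * xi l ord0) ^+ 2.
  rewrite /radial_rate big_split /= mulrDr; congr (_ + _).
  rewrite !mulr_sumr; apply: eq_bigr => j _; rewrite /velX.
  by set S := \sum_(_ < _) _; ring.
have ee : 0 <= e ^+ 2 by exact: sqr_ge0.
have t1 : c * (3 * c ^+ 3 * C ^+ 2 * e ^+ 2 / N1) <= e ^+ 2 / 2.
  have -> : c * (3 * c ^+ 3 * C ^+ 2 * e ^+ 2 / N1) =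
    (6 * c ^+ 4 * C ^+ 2) * (e ^+ 2 / 2) / N1 by field; rewrite lt0r_neq0.
  rewrite ler_pdivrMr// mulrC; apply: ler_wpM2l; first by lra.
  by rewrite /N1 -/c; lra.
have t2 : c * (2 * e * (c * (C / sqn x * e))) <= e ^+ 2 / 4.
  have -> : c * (2 * e * (c * (C / sqn x * e))) =
    (8 * c ^+ 2 * C) * (e ^+ 2 / 4) / sqn x by field; rewrite lt0r_neq0.
  rewrite ler_pdivrMr// mulrC; apply: ler_wpM2l; first by lra.
  by apply: le_trans N1h; rewrite /N1 -/c; lra.
rewrite eE; lra.
Qed.

(** The distance from which the escape estimate applies: 4 + N1 + 64 K, where
    K = 2 n^3 C is the constant in |v'| <= K v^(3/2) / h. *)
Definition far_radius (C : R) : R :=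
  5 + 6 * n%:R ^+ 4 * C ^+ 2 + 8 * n%:R ^+ 2 * C + 128 * n%:R ^+ 3 * C.

Lemma far_radius_ge (c : R) : 0 <= c -> 4 <= far_radius c.
Proof.
move=> c0; rewrite /far_radius.
have : 0 <= 6 * n%:R ^+ 4 * c ^+ 2 by rewrite !mulr_ge0 ?sqr_ge0 ?exprn_ge0.
have : 0 <= 8 * n%:R ^+ 2 * c by rewrite !mulr_ge0 ?sqr_ge0 ?exprn_ge0.
have : 0 <= 128 * n%:R ^+ 3 * c by rewrite !mulr_ge0 ?sqr_ge0 ?exprn_ge0.
lra.
Qed.

(** The escape estimate for bicharacteristics. *)
Lemma flow_escape X Xi (T : R) :
  flow_in a [set s | 0 <= s <= T] X Xi ->
  far_radius C ^+ 2 <= sqn (X 0) -> 0 <= radial a (X 0) (Xi 0) ->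
  0 < sqn (Xi 0) ->
  forall t : R, 0 <= t <= T ->
    sqn (X 0) + sqn (Xi 0) / 2 * t ^+ 2 <= sqn (X t) /\
    sqn (Xi 0) / 2 <= sqn (Xi t) <= 3 / 2 * sqn (Xi 0).
Proof.
move=> fl; apply: (@escape R (fun t => sqn (X t)) (fun t => radial a (X t) (Xi t))
  (fun t => sqn (Xi t)) (fun t => radial_rate a (X t) (Xi t))
  (fun t => \sum_(j < n) 2 * Xi t j ord0 * velXi a (X t) (Xi t) j) T N1
  (far_radius C) (2 * n%:R ^+ 3 * C)).
- have : 0 <= 6 * n%:R ^+ 4 * C ^+ 2 by rewrite !mulr_ge0 ?sqr_ge0 ?exprn_ge0.
  have : 0 <= 8 * n%:R ^+ 2 * C by rewrite !mulr_ge0 ?sqr_ge0 ?exprn_ge0.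
  have : 0 <= 128 * n%:R ^+ 3 * C by rewrite !mulr_ge0 ?sqr_ge0 ?exprn_ge0.
  by rewrite /far_radius /N1 => ? ? ?; apply/andP; split; lra.
- by rewrite !mulr_ge0 ?exprn_ge0.
- have : 0 <= 6 * n%:R ^+ 4 * C ^+ 2 by rewrite !mulr_ge0 ?sqr_ge0 ?exprn_ge0.
  have : 0 <= 8 * n%:R ^+ 2 * C by rewrite !mulr_ge0 ?sqr_ge0 ?exprn_ge0.
  by rewrite /far_radius; lra.
- by move=> s sT; exact: is_derive_sqnX fl _ sT.
- by move=> s sT; apply: is_derive_radial fl _ _ (adm_derivable adm) (adm_dlip adm) sT.
- by move=> s sT; exact: is_derive_sqnXi fl _ sT.
- by move=> s _; exact: far_convex.
- move=> s sT Ns; rewrite -[2 * _ * C / _]mulrA.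
  have N0 : 0 < sqn (X s).
    apply: lt_le_trans Ns; rewrite exprn_gt0// /N1.
    have : 0 <= 6 * n%:R ^+ 4 * C ^+ 2 by rewrite !mulr_ge0 ?sqr_ge0 ?exprn_ge0.
    have : 0 <= 8 * n%:R ^+ 2 * C by rewrite !mulr_ge0 ?sqr_ge0 ?exprn_ge0.
    lra.
  apply: sqnXi_rate_bound => j p l.
  by rewrite ler_pdivlMr// mulrC (adm_ddecay adm).
Qed.

End far_field.
End bicharacteristics.

(** * Uniform bounds by compactness *)

Section uniform_bounds.
Variable R : realType.

(** A monotone bound that holds locally holds uniformly on a box. *)
Lemma box_uniform_bound (N : nat) (M : R) (Q : 'rV[R]_N -> R -> Prop) :
  (forall w c c', c <= c' -> Q w c -> Q w c') ->
  (forall z : 'rV[R]_N, (forall i, `|z ord0 i| <= M) -> exists2 d, 0 < d & exists c,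
     forall w : 'rV[R]_N, (forall i, `|w ord0 i| <= M) ->
       (forall i, `|w ord0 i - z ord0 i| < d) -> Q w c) ->
  exists c, forall w : 'rV[R]_N, (forall i, `|w ord0 i| <= M) -> Q w c.
Proof.
move=> Qmono Qloc.
pose box := [set w : 'rV[R]_N | forall i, `[- M, M]%classic (w ord0 i)].
have boxP (w : 'rV[R]_N) : box w <-> forall i, `|w ord0 i| <= M.
  by split => H i; have := H i; rewrite /= in_itv/= ler_norml.
have cbox : compact box.
  apply: (@rV_compact _ N (fun=> `[- M, M]%classic)).
  by move=> _; exact: segment_compact.
have /choice[dc dcP] : forall z : 'rV[R]_N, exists dc : R * R, 0 < dc.1 /\
    (box z -> forall w, box w ->
       (forall i, `|w ord0 i - z ord0 i| < dc.1) -> Q w dc.2).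
  move=> z; case: (pselect (box z)) => [bz|nbz]; last by exists (1, 0).
  have [d d0 [c H]] := Qloc _ ((boxP z).1 bz).
  by exists (d, c); split => // _ w /boxP; exact: H.
move: cbox; rewrite compact_cover.
move=> /(_ _ box (fun z => interior (ball z (dc z).1))).
case.
- by move=> z _; exact: open_interior.
- by move=> z bz; exists z => //; apply: nbhsx_ballx; exact: (dcP z).1.
move=> D Dbox cov; exists (\sum_(z <- finmap.enum_fset D) `|(dc z).2|) => w /boxP bw.
have [z zD /interior_subset wz] := cov _ bw.
have bz : box z by have := Dbox _ zD; rewrite inE.
apply: (@Qmono _ (dc z).2).
  apply: le_trans (ler_norm _) _.
  by rewrite (big_rem z)//= lerDl sumr_ge0.
apply: (dcP z).2 => // i; rewrite distrC.
by have := wz.2 ord0 i.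
Qed.

Lemma continuous_box_bounded (N : nat) (g : 'cV[R]_N -> R) (M : R) :
  continuous g ->
  exists c, forall x : 'cV[R]_N, (forall i, `|x i ord0| <= M) -> `|g x| <= c.
Proof.
move=> gc.
have [||c cP] := @box_uniform_bound N M (fun w c => `|g w^T| <= c).
- by move=> w c c' cc' /le_trans; apply.
- move=> z _; have : nbhs z^T [set y | `|g z^T - g y| < 1].
    by have /cvgrPdist_lt/(_ 1 ltr01) := gc z^T.
  move=> /nbhs_ballP[e /= e0 eP]; exists e => //; exists (`|g z^T| + 1).
  move=> w _ wz; have : `|g z^T - g w^T| < 1.
    by apply: eP; split=> // i j; rewrite !mxE ord1 /ball/= distrC; exact: wz.
  move=> /ltW H; have -> : g w^T = g z^T - (g z^T - g w^T) by ring.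
  by apply: le_trans (ler_normB _ _) _; rewrite lerD2l.
exists c => x xM; rewrite -[x]trmxK; apply: cP => i; rewrite mxE; exact: xM.
Qed.

Lemma common_bound (I : finType) (Q : I -> R -> Prop) :
  (forall i c c', c <= c' -> Q i c -> Q i c') ->
  (forall i, exists c, Q i c) -> exists2 c, 0 <= c & forall i, Q i c.
Proof.
move=> Qmono /choice[c cP]; exists (\sum_i `|c i|); first exact: sumr_ge0.
move=> i; apply: Qmono (cP i); apply: le_trans (ler_norm _) _.
by rewrite (bigD1 i)//= lerDl sumr_ge0.
Qed.

End uniform_bounds.

(** * Uniform bounds for the truncated symbols *)

Section bounded_C2_functions.
Variables (R : realType) (n : nat).
Implicit Types (f g : 'cV[R]_n -> R) (x v : 'cV[R]_n).

Lemma is_derive_from_line f x v (d : R) :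
  is_derive (0 : R) 1 (fun s => f (x + s *: v)) d -> is_derive x v f d.
Proof.
move=> [fd fE].
have E : (fun h : R => h^-1 *: (((fun s => f (x + s *: v)) \o shift (0 : R)) (h *: 1)
     - f (x + 0 *: v))) =
   (fun h : R => h^-1 *: ((f \o shift x) (h *: v) - f x)).
  apply/funext => h /=; rewrite scale0r !addr0; congr (_ *: (f _ - _)).
  by rewrite -[h *: 1]/(h * 1) mulr1 addrC.
by apply: DeriveDef; rewrite /derivable /derive -E.
Qed.

Lemma is_derive_line0 f x v : derivable f x v ->
  is_derive (0 : R) 1 (fun s => f (x + s *: v)) ('D_v f x).
Proof.
move=> fd; have := @is_derive_line R n f x v 0.
by rewrite scale0r addr0; apply.
Qed.

Lemma is_derive_val f x v (d : R) : is_derive x v f d -> 'D_v f x = d.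
Proof. by case. Qed.

Lemma partial_val f j x (d : R) : is_derive x (delta_mx j ord0) f d ->
  partial j f x = d.
Proof. by case. Qed.

Lemma is_derive_derivable f x v (d : R) : is_derive x v f d -> derivable f x v.
Proof. by case. Qed.

Lemma is_derive_dilate f x v (c : R) : derivable f (c *: x) v ->
  is_derive x v (fun y => f (c *: y)) (c * 'D_v f (c *: x)).
Proof.
move=> fd; apply: is_derive_from_line.
have E : (fun s : R => f (c *: (x + s *: v))) =
    (fun s : R => f (c *: x + (0 + c * s) *: v)).
  by apply/funext => s; rewrite add0r scalerDr scalerA.
rewrite E; apply: (is_derive_affine (f := fun s => f (c *: x + s *: v))).
rewrite mulr0 addr0; have fd' : derivable f (c *: x + 0 *: v) v.
  by rewrite scale0r addr0.
by have := is_derive_line fd'; rewrite scale0r addr0.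
Qed.

(** f and its partial derivatives up to order two, which all exist, are bounded
    by D. *)
Record bounded_C2 (D : R) f : Prop := BoundedC2 {
  bC2_bound : forall x, `|f x| <= D;
  bC2_derivable : forall j x, derivable f x (delta_mx j ord0);
  bC2_bound1 : forall j x, `|partial j f x| <= D;
  bC2_derivable1 : forall i j x, derivable (partial j f) x (delta_mx i ord0);
  bC2_bound2 : forall i j x, `|partial i (partial j f) x| <= D }.

Arguments bC2_derivable {D f} _ j x.
Arguments bC2_derivable1 {D f} _ i j x.

Lemma bounded_C2_lipschitz D f : bounded_C2 D f ->
  coord_lipschitz (n%:R * D) f /\
  forall j, coord_lipschitz (n%:R * D) (partial j f).
Proof.
move=> fD; split=> [|j]; apply: partial_bounded_lipschitz.
- exact: bC2_derivable fD.
- exact: bC2_bound1 fD.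
- by move=> i; exact: bC2_derivable1 fD i j.
- by move=> i; exact: bC2_bound2 fD i j.
Qed.

Lemma is_partialM f g j x : derivable f x (delta_mx j ord0) ->
  derivable g x (delta_mx j ord0) ->
  is_derive x (delta_mx j ord0) (fun y => f y * g y)
    (f x * partial j g x + g x * partial j f x).
Proof.
move=> fd gd; apply: is_derive_from_line.
have := is_derive_mul (is_derive_line0 fd) (is_derive_line0 gd).
by rewrite scale0r addr0.
Qed.

Lemma is_partialD f g j x : derivable f x (delta_mx j ord0) ->
  derivable g x (delta_mx j ord0) ->
  is_derive x (delta_mx j ord0) (fun y => f y + g y)
    (partial j f x + partial j g x).
Proof.
move=> fd gd; apply: is_derive_from_line.
exact: is_derive_add (is_derive_line0 fd) (is_derive_line0 gd).
Qed.

Lemma bounded_C2_mul D E f g : bounded_C2 D f -> bounded_C2 E g ->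
  bounded_C2 (4 * D * E) (fun x => f x * g x).
Proof.
move=> fD gE.
have bound (u w : 'cV[R]_n -> R) x : `|u x| <= D -> `|w x| <= E ->
    `|u x * w x| <= D * E.
  by move=> *; rewrite normrM ler_pM.
have p1 j : partial j (fun x => f x * g x) =
    (fun x => f x * partial j g x + g x * partial j f x).
  by apply/funext => x; apply: partial_val (is_partialM (bC2_derivable fD _ _)
    (bC2_derivable gE _ _)).
have p2 i j x : is_derive x (delta_mx i ord0) (partial j (fun x => f x * g x))
    ((f x * partial i (partial j g) x + partial j g x * partial i f x) +
     (g x * partial i (partial j f) x + partial j f x * partial i g x)).
  rewrite p1.
  have h1 := is_partialM (bC2_derivable fD i x) (bC2_derivable1 gE i j x).
  have h2 := is_partialM (bC2_derivable gE i x) (bC2_derivable1 fD i j x).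
  have [d1 e1] := h1; have [d2 e2] := h2.
  by have := is_partialD d1 d2; rewrite /partial e1 e2.
have f0 := bC2_bound fD; have f1 := bC2_bound1 fD; have f2 := bC2_bound2 fD.
have g0 := bC2_bound gE; have g1 := bC2_bound1 gE; have g2 := bC2_bound2 gE.
have DE : 0 <= D * E.
  by rewrite mulr_ge0// ?(le_trans _ (f0 0))// (le_trans _ (g0 0)).
split.
- by move=> x; have := bound f g x (f0 x) (g0 x); lra.
- move=> j x; exact: (is_derive_derivable (is_partialM
    (bC2_derivable fD j x) (bC2_derivable gE j x))).
- move=> j x; rewrite p1; apply: le_trans (ler_normD _ _) _.
  have := bound f (partial j g) x (f0 x) (g1 j x).
  have := bound (partial j f) g x (f1 j x) (g0 x).
  by rewrite [partial j f x * _]mulrC; lra.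
- by move=> i j x; exact: (is_derive_derivable (p2 i j x)).
- move=> i j x; rewrite (partial_val (p2 i j x)).
  have four (p q r s b : R) : `|p| <= b -> `|q| <= b -> `|r| <= b ->
      `|s| <= b -> `|p + q + (r + s)| <= 4 * b.
    move=> hp hq hr hs; apply: le_trans (ler_normD _ _) _.
    by apply: le_trans (lerD (ler_normD _ _) (ler_normD _ _)) _; lra.
  rewrite -mulrA; apply: four.
  + exact: bound (f0 x) (g2 i j x).
  + by rewrite mulrC; exact: bound (f1 i x) (g1 j x).
  + by rewrite mulrC; exact: bound (f2 i j x) (g0 x).
  + exact: bound (f1 j x) (g1 i x).
Qed.

Lemma bounded_C2_dilate D f (c : R) : 0 <= c <= 1 -> bounded_C2 D f ->
  bounded_C2 D (fun x => f (c *: x)).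
Proof.
move=> /andP[c0 c1] fD.
have p1 j : partial j (fun x => f (c *: x)) = (fun x => c * partial j f (c *: x)).
  by apply/funext => x; apply: partial_val (is_derive_dilate (bC2_derivable fD _ _)).
have p2 i j x : is_derive x (delta_mx i ord0) (partial j (fun x => f (c *: x)))
    (c * (c * partial i (partial j f) (c *: x))).
  rewrite p1; apply: is_derive_from_line; apply: is_derive_scale.
  have H := is_derive_dilate (bC2_derivable1 fD i j (c *: x)).
  rewrite -(is_derive_val H); exact: is_derive_line0 (is_derive_derivable H).
have shrink (y : R) : `|y| <= D -> `|c * y| <= D.
  by move=> yD; apply: le_trans yD; rewrite normrM ger0_norm// ler_piMl.
split.
- by move=> x; exact: bC2_bound fD _.
- by move=> j x; exact: (is_derive_derivable
    (is_derive_dilate (bC2_derivable fD j _))).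
- by move=> j x; rewrite p1; apply: shrink; exact: bC2_bound1 fD _ _.
- by move=> i j x; exact: (is_derive_derivable (p2 i j x)).
- move=> i j x; rewrite (partial_val (p2 i j x)).
  exact: shrink _ (shrink _ (bC2_bound2 fD _ _ _)).
Qed.

Lemma bounded_C2_cst1 : bounded_C2 1 (fun=> 1).
Proof.
have p1 j : partial j (fun=> 1 : R) = (fun=> 0) :> ('cV[R]_n -> R).
  by apply/funext => x; exact: derive_cst.
split.
- by move=> x; rewrite normr1.
- by move=> j x; exact: derivable_cst.
- by move=> j x; rewrite p1 normr0.
- by move=> i j x; rewrite p1; exact: derivable_cst.
- by move=> i j x; rewrite p1 /partial derive_cst normr0.
Qed.

Lemma bounded_C2_mono D E f : D <= E -> bounded_C2 D f -> bounded_C2 E f.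
Proof.
by move=> DE [f0 f1d f1 f2d f2]; split => // *; apply: le_trans DE.
Qed.

Lemma sqn_line_continuous x v :
  {for (0 : R), continuous (fun s : R => sqn (x + s *: v))}.
Proof.
apply: (@is_derive_continuous _ _ _ (\sum_(i < n)
   2 * (x i ord0 + v i ord0 * 0) * (0 + v i ord0 * 1))).
have -> : (fun s : R => sqn (x + s *: v)) =
    (fun s => \sum_(i < n) (x i ord0 + v i ord0 * s) ^+ 2).
  apply/funext => s; apply: eq_bigr => i _; rewrite !mxE.
  by congr ((_ + _) ^+ 2); exact: mulrC.
apply: (is_derive_bigsum _ (F := fun i s => (x i ord0 + v i ord0 * s) ^+ 2)
  (dF := fun i s => 2 * (x i ord0 + v i ord0 * s) * (0 + v i ord0 * 1))) => i.
exact: is_derive_sqr (is_derive_add (is_derive_const _ _)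
  (is_derive_scale _ (is_derive_idfun _))).
Qed.

(** All iterated partial derivatives vanish off the support. *)
Lemma iter_partial_off_support f (r : R) js :
  (forall x, r < sqn x -> f x = 0) ->
  forall x, r < sqn x -> iter_partial js f x = 0.
Proof.
move=> f0; elim: js => [|j js IH] x rx /=; first exact: f0.
apply: partial_val; apply: is_derive_from_line.
pose v : 'cV[R]_n := delta_mx j ord0.
have cs := @sqn_line_continuous x v.
have rx0 : r < sqn (x + 0 *: v) by rewrite scale0r addr0.
have [e e0 eP] := continuous_gt_near cs rx0.
apply: (@near_eq_is_derive _ _ _ (fun=> 0)).
near=> s; apply/esym/IH; apply: eP; rewrite distrC.
by near: s; apply: (@nbhsx_ballx _ _ (0 : R) e).
Unshelve. all: by end_near. Qed.

Lemma smooth_compact_support_bounded f : smooth f ->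
  (forall x, 4 < sqn x -> f x = 0) ->
  forall js, exists c, forall x, `|iter_partial js f x| <= c.
Proof.
move=> fs f0 js; have [c cP] := continuous_box_bounded 2 (fs js).1.
exists `|c| => x; have [x4|x4] := leP (sqn x) 4.
  apply: le_trans (ler_norm c); apply: cP => i.
  rewrite -(@ler_pXn2r _ 2)// ?nnegrE// real_normK ?num_real//.
  by apply: le_trans (sqr_coord_le x i) _; lra.
by rewrite (iter_partial_off_support js f0 x4) normr0.
Qed.

Lemma bounded_C2_smooth f : smooth f ->
  (forall js, exists c, forall x, `|iter_partial js f x| <= c) ->
  exists2 D, 0 <= D & bounded_C2 D f.
Proof.
move=> fs fb.
have [c0 c0P] := fb [::].
have [c1 c10 c1P] := @common_bound R 'I_n
  (fun j c => forall x, `|iter_partial [:: j] f x| <= c)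
  (fun j c c' cc H x => le_trans (H x) cc) (fun j => fb [:: j]).
have [c2 c20 c2P] := @common_bound R ('I_n * 'I_n)%type
  (fun p c => forall x, `|iter_partial [:: p.1; p.2] f x| <= c)
  (fun p c c' cc H x => le_trans (H x) cc) (fun p => fb [:: p.1; p.2]).
exists (`|c0| + c1 + c2); first by rewrite !addr_ge0.
have n0 : 0 <= `|c0| by [].
have l0 := ler_norm c0.
split.
- by move=> x; have := c0P x => /=; lra.
- by move=> j x; exact: (fs [::]).2.
- by move=> j x; have := c1P j x => /=; lra.
- by move=> i j x; exact: (fs [:: j]).2.
- by move=> i j x; have := c2P (i, j) x => /=; lra.
Qed.

End bounded_C2_functions.
Arguments bC2_derivable {R n D f} _ j x.
Arguments bC2_derivable1 {R n D f} _ i j x.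

Section truncation.
Variables (R : realType) (n k : nat).
Implicit Types (A : 'cV[R]_n -> 'M[R]_n) (theta f : 'cV[R]_n -> R).

(** The multi-indices alpha = 0 and alpha = 2 e_i suffice. *)
Lemma schwartz_decay f js : schwartz f ->
  exists c, forall x : 'cV[R]_n, `|iter_partial js f x| <= c /\
                      sqn x * `|iter_partial js f x| <= c.
Proof.
move=> [fs fd].
have [c0 c0P] := fd (fun=> 0%N) js.
have d2 i : exists c, forall x : 'cV[R]_n,
    `|x i ord0 ^+ 2 * iter_partial js f x| <= c.
  have [c cP] := fd (fun j => if j == i then 2%N else 0%N) js.
  exists c => x; have := cP x; rewrite (bigD1 i)//= eqxx big1 ?mulr1// => j ji.
  by rewrite (negbTE ji) expr0.
have [c1 c10 c1P] := @common_bound R 'I_n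
  (fun i c => forall x : 'cV[R]_n, `|x i ord0 ^+ 2 * iter_partial js f x| <= c)
  (fun i c c' cc H x => le_trans (H x) cc) d2.
exists (`|c0| + n%:R * c1) => x; have := c0P x.
rewrite big1 ?mul1r => [b0|i _]; last by rewrite expr0.
have l0 := ler_norm c0.
have nc : 0 <= n%:R * c1 by rewrite mulr_ge0.
split; first by lra.
have : `|\sum_(i < n) x i ord0 ^+ 2 * iter_partial js f x| <= n%:R * c1.
  by apply: ler_norm_sum_ord => i; exact: c1P.
rewrite -mulr_suml normrM ger0_norm; last exact: sqn_ge0.
by have := normr_ge0 c0; rewrite /sqn; lra.
Qed.

Lemma truncatedE theta A (r : R) x j l :
  truncated theta A (Ah R n k) r%:E x j l =
  Ah R n k j l + theta (r^-1 *: x) * (A x j l - Ah R n k j l).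
Proof. by rewrite /truncated !mxE; ring. Qed.

(** The truncated symbols are admissible with constants that do not depend on
    rho: dilating theta by 1 / rho <= 1 does not increase its derivatives. *)
Lemma truncated_admissible theta A :
  smooth theta -> (forall x, 0 <= theta x <= 1) ->
  (forall x, 4 < sqn x -> theta x = 0) ->
  (forall j l, schwartz (fun x => A x j l - Ah R n k j l)) ->
  exists C K, forall rho : \bar R, (1 < rho)%E ->
    admissible k C K (truncated theta A (Ah R n k) rho).
Proof.
move=> ts t01 tsupp As.
have [Dt Dt0 tD] := bounded_C2_smooth ts (smooth_compact_support_bounded ts tsupp).
pose B j l x := A x j l - Ah R n k j l.
have [DB DB0 BD] := @common_bound R ('I_n * 'I_n)%type
  (fun p c => bounded_C2 c (B p.1 p.2))
  (fun p c c' cc => bounded_C2_mono cc)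
  (fun p => let: ex_intro2 c _ H := bounded_C2_smooth (As p.1 p.2).1
    (fun js => let: ex_intro c H := schwartz_decay js (As p.1 p.2) in
      ex_intro _ c (fun x => (H x).1)) in ex_intro _ c H).
have [c0 c00 c0P] := @common_bound R ('I_n * 'I_n)%type
  (fun p c => forall x : 'cV[R]_n, `|B p.1 p.2 x| <= c /\ sqn x * `|B p.1 p.2 x| <= c)
  (fun p c c' cc H x => conj (le_trans (H x).1 cc) (le_trans (H x).2 cc))
  (fun p => schwartz_decay [::] (As p.1 p.2)).
have [c1 c10 c1P] := @common_bound R ('I_n * 'I_n * 'I_n)%type
  (fun p c => forall x : 'cV[R]_n, `|partial p.2 (B p.1.1 p.1.2) x| <= c /\
     sqn x * `|partial p.2 (B p.1.1 p.1.2) x| <= c)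
  (fun p c c' cc H x => conj (le_trans (H x).1 cc) (le_trans (H x).2 cc))
  (fun p => schwartz_decay [:: p.2] (As p.1.1 p.1.2)).
pose E := Dt + 1.
have E1 : 1 <= E by rewrite /E; lra.
pose C := E * (1 + c0 + c1); pose K := n%:R * (4 * E * DB).
have C0 : 0 <= C by rewrite mulr_ge0//; lra.
have K0 : 0 <= K by rewrite !mulr_ge0//; lra.
exists C, K => rho rho1.
(* the cut-off at scale rho, uniformly bounded with its derivatives *)
have [t [t01' tE aE]] : exists t : 'cV[R]_n -> R, [/\ forall x, `|t x| <= 1,
    bounded_C2 E t & forall j l, (fun x => truncated theta A (Ah R n k) rho x j l) =
      (fun x => Ah R n k j l + t x * B j l x)].
  case: rho rho1 => [r| |//] r1; last first.
    exists (fun=> 1); split.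
    - by move=> x; rewrite normr1.
    - exact: bounded_C2_mono E1 (@bounded_C2_cst1 R n).
    - by move=> j l; apply/funext => x; rewrite mul1r addrC subrK.
  have r1' : 1 < r by rewrite lte_fin in r1.
  exists (fun x => theta (r^-1 *: x)); split.
  - by move=> x; have /andP[? ?] := t01 (r^-1 *: x); rewrite ger0_norm.
  - apply: (@bounded_C2_mono _ _ Dt); first by rewrite /E; lra.
    by apply: bounded_C2_dilate => //; rewrite invr_ge0 invf_le1; lra.
  - by move=> j l; apply/funext => x; rewrite truncatedE.
have bD j l : bounded_C2 (4 * E * DB) (fun x => t x * B j l x).
  exact: bounded_C2_mul tE (BD (j, l)).
have cst (c : R) m (z : 'cV[R]_n) : is_derive z (delta_mx m ord0) (fun=> c) 0.
  exact: is_derive_cst.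
have pa j l m : partial m (fun x => truncated theta A (Ah R n k) rho x j l) =
    partial m (fun x => t x * B j l x).
  apply/funext => z; rewrite aE.
  have [d0 e0] := cst (Ah R n k j l) m z.
  have := is_partialD d0 (bC2_derivable (bD j l) m z).
  by rewrite {1}/partial e0 add0r => /partial_val.
have pb j l m z : partial m (fun x => t x * B j l x) z =
    t z * partial m (B j l) z + B j l z * partial m t z.
  apply: partial_val (is_partialM (bC2_derivable tE _ _)
    (bC2_derivable (BD (j, l)) _ _)).
have Ah1 j l : `|Ah R n k j l| <= 1.
  rewrite !mxE; case: (j == l); last by rewrite mulr0n normr0.
  by rewrite mulr1n; case: ifP => _; rewrite ?normrN normr1.
have C1 : 1 + c0 + c1 <= C by rewrite -[leLHS]mul1r ler_wpM2r//; lra.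
have tB j l x : `|t x * B j l x| <= `|B j l x|.
  by rewrite normrM ler_piMl.
have pbb j l m z (w : R) : 0 <= w -> w * `|partial m (B j l) z| <= c1 ->
    w * `|B j l z| <= c0 -> w * `|partial m (fun x => t x * B j l x) z| <= C.
  move=> w0 w1 w2; rewrite pb.
  apply: (@le_trans _ _ (w * (`|partial m (B j l) z| + `|B j l z| * E))).
    apply: ler_wpM2l => //; apply: le_trans (ler_normD _ _) _.
    rewrite !normrM; apply: lerD; first by rewrite ler_piMl.
    by apply: ler_wpM2l => //; exact: bC2_bound1 tE _ _.
  rewrite mulrDr mulrA.
  have : w * `|B j l z| * E <= c0 * E by apply: ler_wpM2r => //; lra.
  have : 0 <= c1 * Dt by rewrite mulr_ge0.
  by rewrite /C /E; lra.
split=> //.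
- move=> j l m z; rewrite aE.
  by have [d0 _] := cst (Ah R n k j l) m z;
    have [] := is_partialD d0 (bC2_derivable (bD j l) m z).
- move=> j l x; have -> : truncated theta A (Ah R n k) rho x j l =
    Ah R n k j l + t x * B j l x by rewrite -[RHS]/((fun _ => _) x) -aE.
  apply: le_trans (ler_normD _ _) _.
  by have := tB j l x; have := Ah1 j l; have := (c0P (j, l) x).1 => /=; lra.
- move=> j l m x; rewrite pa -[leLHS]mul1r; apply: pbb => //; rewrite mul1r.
    exact: (c1P (j, l, m) x).1.
  exact: (c0P (j, l) x).1.
- move=> j l x; have -> : truncated theta A (Ah R n k) rho x j l =
    Ah R n k j l + t x * B j l x by rewrite -[RHS]/((fun _ => _) x) -aE.
  rewrite addrAC subrr add0r.
  have := ler_wpM2l (sqn_ge0 x) (tB j l x).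
  by have := (c0P (j, l) x).2 => /=; lra.
- move=> j l m x; rewrite pa; apply: pbb; first exact: sqn_ge0.
    exact: (c1P (j, l, m) x).2.
  exact: (c0P (j, l) x).2.
- move=> j l; rewrite aE => x y d xy; rewrite opprD addrACA subrr add0r.
  exact: (bounded_C2_lipschitz (bD j l)).1 xy.
- by move=> j l m; rewrite pa; exact: (bounded_C2_lipschitz (bD j l)).2.
Qed.

End truncation.

(** * Existence and continuous dependence of bicharacteristics *)

Section phase_space_distance.
Variables (R : realType) (n : nat).

(** Squared distance in phase space. *)
Definition sqdist (x xi y eta : 'cV[R]_n) : R := sqn (x - y) + sqn (xi - eta).

Lemma is_derive_sqdist (a b : 'cV[R]_n -> 'M[R]_n) (D : set R)
    (X Xi Y Eta : R -> 'cV[R]_n) (s : R) :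
  flow_in a D X Xi -> flow_in b D Y Eta -> D s ->
  is_derive s 1 (fun t => sqdist (X t) (Xi t) (Y t) (Eta t))
    (\sum_(j < n) 2 * (X s j ord0 - Y s j ord0) *
        (velX a (X s) (Xi s) j - velX b (Y s) (Eta s) j) +
     \sum_(j < n) 2 * (Xi s j ord0 - Eta s j ord0) *
        (velXi a (X s) (Xi s) j - velXi b (Y s) (Eta s) j)).
Proof.
move=> fX fY Ds.
have -> : (fun t => sqdist (X t) (Xi t) (Y t) (Eta t)) =
    (fun t => \sum_(j < n) (X t j ord0 - Y t j ord0) ^+ 2 +
              \sum_(j < n) (Xi t j ord0 - Eta t j ord0) ^+ 2).
  by apply/funext => t; rewrite /sqdist /sqn; congr (_ + _);
    apply: eq_bigr => j _; rewrite !mxE.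
have h1 : is_derive s 1 (fun t => \sum_(j < n) (X t j ord0 - Y t j ord0) ^+ 2)
    (\sum_(j < n) 2 * (X s j ord0 - Y s j ord0) *
             (velX a (X s) (Xi s) j - velX b (Y s) (Eta s) j)).
  apply: (is_derive_bigsum _ (F := fun j t => (X t j ord0 - Y t j ord0) ^+ 2)
    (dF := fun j s => 2 * (X s j ord0 - Y s j ord0) *
             (velX a (X s) (Xi s) j - velX b (Y s) (Eta s) j))) => j.
  exact: is_derive_sqr (is_derive_sub (fX s Ds j).1 (fY s Ds j).1).
have h2 : is_derive s 1 (fun t => \sum_(j < n) (Xi t j ord0 - Eta t j ord0) ^+ 2)
    (\sum_(j < n) 2 * (Xi s j ord0 - Eta s j ord0) *
             (velXi a (X s) (Xi s) j - velXi b (Y s) (Eta s) j)).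
  apply: (is_derive_bigsum _ (F := fun j t => (Xi t j ord0 - Eta t j ord0) ^+ 2)
    (dF := fun j s => 2 * (Xi s j ord0 - Eta s j ord0) *
             (velXi a (X s) (Xi s) j - velXi b (Y s) (Eta s) j))) => j.
  exact: is_derive_sqr (is_derive_sub (fX s Ds j).2 (fY s Ds j).2).
exact: is_derive_add h1 h2.
Qed.

End phase_space_distance.

Section hamilton_field_lipschitz.
Variables (R : realType) (n k : nat) (C K : R) (a : 'cV[R]_n -> 'M[R]_n).
Hypothesis adm : admissible k C K a.
Implicit Types (x y xi eta : 'cV[R]_n).

Let C0 := adm_C adm.
Let K0 := adm_K adm.

(** Lipschitz constant of the Hamilton field on momenta of size at most L. *)
Definition field_lip (L : R) : R :=
  2 * n%:R * (K * L + C) + n%:R ^+ 2 * (K * L ^+ 2 + 2 * C * L).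

Lemma field_lip_ge0 L : 0 <= L -> 0 <= field_lip L.
Proof.
by move=> L0; rewrite addr_ge0// !mulr_ge0 ?exprn_ge0// addr_ge0 ?mulr_ge0 ?exprn_ge0.
Qed.

Lemma velX_lipschitz (L d : R) x y xi eta j : 0 <= L -> 0 <= d ->
  (forall i, `|x i ord0 - y i ord0| <= d) ->
  (forall i, `|xi i ord0 - eta i ord0| <= d) ->
  (forall i, `|xi i ord0| <= L) -> (forall i, `|eta i ord0| <= L) ->
  `|velX a x xi j - velX a y eta j| <= field_lip L * d.
Proof.
move=> L0 d0 xy xe xiL etaL.
have H : `|velX a x xi j - velX a y eta j| <= 2 * (n%:R * ((K * L + C) * d)).
  rewrite /velX -mulrBr -sumrB normrM ger0_norm// ler_wpM2l//.
  apply: ler_norm_sum_ord => l.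
  have -> : a x j l * xi l ord0 - a y j l * eta l ord0 =
    (a x j l - a y j l) * xi l ord0 + a y j l * (xi l ord0 - eta l ord0) by ring.
  apply: le_trans (ler_normD _ _) _; rewrite !normrM.
  have -> : (K * L + C) * d = K * d * L + C * d by ring.
  by apply: lerD; apply: ler_pM => //;
    [exact: (adm_lip adm j l xy)|exact: (adm_bound adm)].
apply: le_trans H _; rewrite /field_lip mulrDl.
have : 0 <= n%:R ^+ 2 * (K * L ^+ 2 + 2 * C * L) * d.
  by rewrite !mulr_ge0 ?exprn_ge0// addr_ge0 ?mulr_ge0 ?exprn_ge0.
lra.
Qed.

Lemma velXi_lipschitz (L d : R) x y xi eta j : 0 <= L -> 0 <= d ->
  (forall i, `|x i ord0 - y i ord0| <= d) ->
  (forall i, `|xi i ord0 - eta i ord0| <= d) ->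
  (forall i, `|xi i ord0| <= L) -> (forall i, `|eta i ord0| <= L) ->
  `|velXi a x xi j - velXi a y eta j| <= field_lip L * d.
Proof.
move=> L0 d0 xy xe xiL etaL.
have H : `|velXi a x xi j - velXi a y eta j| <=
    n%:R * (n%:R * ((K * L ^+ 2 + 2 * C * L) * d)).
  rewrite /velXi -opprD normrN -sumrB; apply: ler_norm_sum_ord => p.
  rewrite -sumrB; apply: ler_norm_sum_ord => l.
  set P := partial j (fun x => a x p l).
  have -> : P x * xi p ord0 * xi l ord0 - P y * eta p ord0 * eta l ord0 =
    (P x - P y) * (xi p ord0 * xi l ord0) +
    (P y * ((xi p ord0 - eta p ord0) * xi l ord0) +
     P y * (eta p ord0 * (xi l ord0 - eta l ord0))) by ring.
  apply: le_trans (ler_normD _ _) _.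
  apply: le_trans (lerD (lexx _) (ler_normD _ _)) _.
  have -> : (K * L ^+ 2 + 2 * C * L) * d =
    K * d * (L * L) + (C * (d * L) + C * (L * d)) by ring.
  rewrite !normrM; apply: lerD; [|apply: lerD].
  - have := adm_dlip adm p l j xy; rewrite -/P => Pxy.
    by apply: ler_pM => //; apply: ler_pM.
  - have Py : `|P y| <= C by exact: (adm_dbound adm).
    by apply: ler_pM => //; apply: ler_pM.
  - have Py : `|P y| <= C by exact: (adm_dbound adm).
    by apply: ler_pM => //; apply: ler_pM.
apply: le_trans H _; rewrite /field_lip [leRHS]mulrDl expr2.
have : 0 <= 2 * n%:R * (K * L + C) * d.
  by rewrite !mulr_ge0// addr_ge0 ?mulr_ge0.
rewrite -!mulrA; lra.
Qed.

(** Projection onto [-L, L], applied below to each coordinate of a momentum. *)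
Definition clamp (L t : R) : R := Num.max (- L) (Num.min L t).

Lemma clamp_norm L t : 0 <= L -> `|clamp L t| <= L.
Proof.
move=> L0; rewrite /clamp ler_norml le_max lexx/= ge_max ge_min lexx/= andbT; lra.
Qed.

Lemma clamp_id L t : `|t| <= L -> clamp L t = t.
Proof.
by rewrite ler_norml => /andP[t1 t2]; rewrite /clamp min_r// max_r.
Qed.

Lemma clamp_lip L s t : 0 <= L -> `|clamp L s - clamp L t| <= `|s - t|.
Proof.
move=> L0; rewrite /clamp.
have two (p : R) : p <= `|s - t| -> - p <= `|s - t| -> `|p| <= `|s - t|.
  by move=> h1 h2; rewrite ler_norml; apply/andP; split; lra.
have h1 := ler_norm (s - t).
have h2 := ler_norm (t - s); rewrite distrC in h2.
have h0 := normr_ge0 (s - t).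
rewrite !maxEle !minEle.
by case: (leP L s) => h3; case: (leP L t) => h4;
  repeat case: ifPn; rewrite -?ltNge => *; apply: two; lra.
Qed.

(** Global integral curves exist once momenta are truncated. *)
Lemma clamped_flow (L : R) (x0 xi0 : 'cV[R]_n) : 0 <= L ->
  exists X Xi : R -> 'cV[R]_n, [/\ X 0 = x0, Xi 0 = xi0 &
    forall (s : R) (j : 'I_n),
      is_derive s 1 (fun t => X t j ord0)
        (velX a (X s) (\col_i clamp L (Xi s i ord0)) j) /\
      is_derive s 1 (fun t => Xi t j ord0)
        (velXi a (X s) (\col_i clamp L (Xi s i ord0)) j)].
Proof.
move=> L0; pose I := ('I_n + 'I_n)%type.
pose px (z : I -> R) : 'cV[R]_n := \col_i z (inl i).
pose pxi (z : I -> R) : 'cV[R]_n := \col_i clamp L (z (inr i)).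
pose F (z : I -> R) (i : I) : R := match i with
  | inl j => velX a (px z) (pxi z) j | inr j => velXi a (px z) (pxi z) j end.
pose z0 (i : I) : R := match i with inl j => x0 j ord0 | inr j => xi0 j ord0 end.
have pxiL z i : `|pxi z i ord0| <= L by rewrite mxE clamp_norm.
have Flip : sup_lipschitz F (field_lip L).
  move=> z w d zw j.
  have d0 : 0 <= d by exact: le_trans (normr_ge0 _) (zw j).
  have h1 i : `|px z i ord0 - px w i ord0| <= d by rewrite !mxE.
  have h2 i : `|pxi z i ord0 - pxi w i ord0| <= d.
    by rewrite !mxE; apply: le_trans (clamp_lip _ _ L0) _.
  by case: j => j; [exact: velX_lipschitz|exact: velXi_lipschitz].
have sqL (z : I -> R) : sqn (pxi z) <= n%:R * L ^+ 2.
  rewrite -[leLHS]ger0_norm ?sqn_ge0//; apply: ler_norm_sum_ord => i.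
  by rewrite normrX ler_pXn2r// nnegrE.
pose B := 2 * (n%:R * (C * Num.sqrt (n%:R * L ^+ 2))) + n%:R ^+ 2 * C * (n%:R * L ^+ 2).
have B1 : 0 <= 2 * (n%:R * (C * Num.sqrt (n%:R * L ^+ 2))).
  by rewrite !mulr_ge0// sqrtr_ge0.
have B2 : 0 <= n%:R ^+ 2 * C * (n%:R * L ^+ 2) by rewrite !mulr_ge0 ?exprn_ge0.
have FB z i : `|F z i| <= B.
  case: i => j /=.
    apply: le_trans (velX_bound adm _ _ _) _; rewrite /B -[leLHS]addr0.
    apply: lerD => //; do 3 apply: ler_wpM2l => //.
    exact: ler_wsqrtr.
  apply: le_trans (@velXi_bound R n a _ _ j C _) _.
    by move=> p l; exact: (adm_dbound adm).
  rewrite /B -[leLHS]add0r; apply: lerD => //.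
  by apply: ler_wpM2l => //; rewrite mulr_ge0 ?exprn_ge0.
have [u u0 ud] := ode_global_existence z0 (addr_ge0 B1 B2) Flip FB.
exists (fun t => \col_i u t (inl i)), (fun t => \col_i u t (inr i)); split.
- by apply/colP => i; rewrite mxE u0.
- by apply/colP => i; rewrite mxE u0.
move=> s j.
have E : (\col_i clamp L ((\col_i0 u s (inr i0)) i ord0) : 'cV[R]_n) = pxi (u s).
  by apply/colP => i; rewrite !mxE.
have e1 : (fun t : R => (\col_i u t (inl i) : 'cV[R]_n) j ord0) = (fun t => u t (inl j)).
  by apply/funext => t; rewrite mxE.
have e2 : (fun t : R => (\col_i u t (inr i) : 'cV[R]_n) j ord0) = (fun t => u t (inr j)).
  by apply/funext => t; rewrite mxE.
rewrite E e1 e2; split; [exact: (ud s (inl j))|exact: (ud s (inr j))].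
Qed.

(** Continuous dependence on the data, by Gronwall's argument. *)
Lemma flow_gronwall (X Xi Y Eta : R -> 'cV[R]_n) (T L : R) : 0 <= L ->
  flow_in a [set s | 0 <= s <= T] X Xi ->
  flow_in a [set s | 0 <= s <= T] Y Eta ->
  (forall s i, 0 <= s <= T -> `|Xi s i ord0| <= L) ->
  (forall s i, 0 <= s <= T -> `|Eta s i ord0| <= L) ->
  0 <= T ->
  sqdist (X T) (Xi T) (Y T) (Eta T) <=
  sqdist (X 0) (Xi 0) (Y 0) (Eta 0) * expR (4 * n%:R * field_lip L * T).
Proof.
move=> L0 fX fY XiL EtaL T0.
pose S t := sqdist (X t) (Xi t) (Y t) (Eta t).
pose dS t := \sum_(j < n) 2 * (X t j ord0 - Y t j ord0) *
               (velX a (X t) (Xi t) j - velX a (Y t) (Eta t) j) +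
             \sum_(j < n) 2 * (Xi t j ord0 - Eta t j ord0) *
               (velXi a (X t) (Xi t) j - velXi a (Y t) (Eta t) j).
have Sd s : 0 <= s <= T -> is_derive s 1 S (dS s).
  exact: is_derive_sqdist fX fY.
pose G := 4 * n%:R * field_lip L.
have dSb s : 0 <= s <= T -> dS s <= G * S s.
  move=> sT; pose d := Num.sqrt (S s).
  have S0 : 0 <= S s by rewrite addr_ge0// sqn_ge0.
  have d0 : 0 <= d by exact: sqrtr_ge0.
  have dE : d ^+ 2 = S s by rewrite sqr_sqrtr.
  have h1 i : `|X s i ord0 - Y s i ord0| <= d.
    rewrite -[_ - _]/(GRing.add _ _) -sqrtr_sqr ler_wsqrtr//.
    have := sqr_coord_le (X s - Y s) i; rewrite !mxE => /le_trans; apply.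
    by rewrite /S /sqdist lerDl sqn_ge0.
  have h2 i : `|Xi s i ord0 - Eta s i ord0| <= d.
    rewrite -sqrtr_sqr ler_wsqrtr//.
    have := sqr_coord_le (Xi s - Eta s) i; rewrite !mxE => /le_trans; apply.
    by rewrite /S /sqdist lerDr sqn_ge0.
  have b1 j := velX_lipschitz j L0 d0 h1 h2 (XiL s ^~ sT) (EtaL s ^~ sT).
  have b2 j := velXi_lipschitz j L0 d0 h1 h2 (XiL s ^~ sT) (EtaL s ^~ sT).
  have -> : G * S s = n%:R * (2 * d * (field_lip L * d)) +
                      n%:R * (2 * d * (field_lip L * d)).
    by rewrite -dE /G; ring.
  apply: lerD; apply: le_trans (ler_norm _) _; apply: ler_norm_sum_ord => j.
  - by rewrite normrM; apply: ler_pM => //; rewrite normrM ger0_norm// ler_wpM2l.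
  - by rewrite normrM; apply: ler_pM => //; rewrite normrM ger0_norm// ler_wpM2l.
pose E s := expR (0 + - G * s).
have Ed (s : R) : is_derive s 1 E (- G * E s).
  exact: is_derive_affine (is_derive_expR _).
have : - (S 0 * E 0) <= - (S T * E T).
  apply: (@ge0_derive_le _ (fun s => - (S s * E s))
    (fun s => - (S s * (- G * E s) + E s * dS s))) => // s sT.
    exact: is_derive_opp (is_derive_mul (Sd s sT) (Ed s)).
  have := ler_wpM2l (expR_ge0 (0 + - G * s)) (dSb s sT).
  rewrite -/(E s); lra.
rewrite lerN2 /E add0r mulr0 addr0 expR0 mulr1 mulNr expRN -/G.
by rewrite ler_pdivrMr ?expR_gt0.
Qed.

(** A lower Gronwall bound: momenta that start away from 0 do not vanish. *)
Lemma momentum_lower_bound (X Xi : R -> 'cV[R]_n) (T b : R) : 0 <= T ->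
  flow_in a [set s | 0 <= s <= T] X Xi ->
  (forall s, 0 <= s <= T -> sqn (Xi s) <= b) ->
  sqn (Xi 0) <= sqn (Xi T) * expR (2 * n%:R ^+ 3 * C * Num.sqrt b * T).
Proof.
move=> T0 fl vb; pose G := 2 * n%:R ^+ 3 * C * Num.sqrt b.
pose E (s : R) := expR (0 + G * s).
have Ed (s : R) : is_derive s 1 E (G * E s).
  exact: is_derive_affine (is_derive_expR _).
have := @ge0_derive_le R (fun s => sqn (Xi s) * E s) _ 0 T T0
  (fun s sT => is_derive_mul (is_derive_sqnXi fl sT) (Ed s)).
rewrite /E !add0r mulr0 expR0 mulr1; apply => s sT.
set u := \sum_(_ < _) _.
have ub : `|u| <= 2 * n%:R ^+ 3 * C * (sqn (Xi s) * Num.sqrt (sqn (Xi s))).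
  by apply: sqnXi_rate_bound => j p l; exact: (adm_dbound adm).
have : sqn (Xi s) * Num.sqrt (sqn (Xi s)) <= sqn (Xi s) * Num.sqrt b.
  by rewrite ler_wpM2l ?sqn_ge0// ler_wsqrtr// vb.
have G0 : 0 <= 2 * n%:R ^+ 3 * C by rewrite !mulr_ge0// exprn_ge0.
move=> /(ler_wpM2l G0) b1.
have : 0 <= sqn (Xi s) * G + u.
  move: ub b1; rewrite ler_norml /G => /andP[? _] ?; lra.
move=> /(mulr_ge0 (expR_ge0 (0 + G * s))); rewrite -/(E s); lra.
Qed.

End hamilton_field_lipschitz.

Section truncated_symbol.
Variables (R : realType) (n k : nat).
Implicit Types (A : 'cV[R]_n -> 'M[R]_n) (theta : 'cV[R]_n -> R).

(** Inside the ball of radius rho the truncated flow is the flow of A. *)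
Lemma flow_in_truncated theta A (rho : \bar R) (D : set R) X Xi :
  (forall x, enorm x <= 1 -> theta x = 1) ->
  (forall p l m z, derivable (fun x => A x p l) z (delta_mx m ord0)) ->
  (1 < rho)%E -> (forall s, D s -> ((enorm (X s))%:E < rho)%E) ->
  flow_in (truncated theta A (Ah R n k) rho) D X Xi -> flow_in A D X Xi.
Proof.
move=> t1 Ad; case: rho => [r| |//] r1 Xr fl //.
move=> s Ds; have := fl s Ds; have := Xr s Ds; rewrite lte_fin in r1.
rewrite lte_fin => xr.
set a := truncated _ _ _ _ => fls j.
have aE x : enorm x <= r -> a x = A x.
  move=> xler; rewrite /a /truncated t1 ?scale1r ?subrr ?scale0r ?addr0//.
  have -> : enorm (r^-1 *: x) = r^-1 * enorm x.
    rewrite /enorm -{2}[r^-1]ger0_norm ?invr_ge0; last lra.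
    rewrite -sqrtr_sqr -sqrtrM ?sqr_ge0//; congr Num.sqrt.
    by rewrite mulr_sumr; apply: eq_bigr => i _; rewrite mxE exprMn.
  by rewrite mulrC ler_pdivrMr ?mul1r//; lra.
have daE j0 p l : partial j0 (fun x => a x p l) (X s) =
    partial j0 (fun x => A x p l) (X s).
  pose v : 'cV[R]_n := delta_mx j0 ord0.
  have xr0 : sqn (X s + 0 *: v) < r ^+ 2.
    rewrite scale0r addr0 -enorm_sqr ltr_pXn2r// nnegrE ?enorm_ge0//; lra.
  have [e e0 eP] := continuous_lt_near (@sqn_line_continuous R n (X s) v) xr0.
  apply: partial_val; apply: is_derive_from_line.
  apply: near_eq_is_derive (is_derive_line0 (Ad p l j0 (X s))).
  near=> t; rewrite aE// -(@ler_pXn2r _ 2)// ?nnegrE ?enorm_ge0//; last lra.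
  rewrite enorm_sqr; apply/ltW/eP; rewrite distrC.
  by near: t; apply: (@nbhsx_ballx _ _ (0 : R) e).
have E1 : velX a (X s) (Xi s) j = velX A (X s) (Xi s) j.
  by rewrite /velX; under eq_bigr do rewrite aE ?(ltW xr)//.
have E2 : velXi a (X s) (Xi s) j = velXi A (X s) (Xi s) j.
  rewrite /velXi; congr (- _); apply: eq_bigr => p _; apply: eq_bigr => l _.
  by rewrite daE.
by rewrite -E1 -E2; exact: fls.
Unshelve. all: by end_near. Qed.

End truncated_symbol.

(** * Uniform exit from a ball *)

Section near_region.
Variable R : realType.

(** A function that climbs from lo to hi is, at some time, above lo and
    non-decreasing to first order. *)
Lemma upcrossing (h dh : R -> R) (T lo hi : R) : lo < hi -> 0 <= T ->
  (forall s : R, 0 <= s <= T -> is_derive s 1 h (dh s)) ->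
  h 0 <= lo -> hi <= h T -> exists2 t, 0 <= t <= T & lo <= h t /\ 0 <= dh t.
Proof.
move=> lohi T0 hd h0 hT.
have [|W|[t [tT Wt before]]] := @first_failure R (fun s => h s < hi) T.
- move=> t tT; exact: continuous_lt_near (is_derive_continuous (hd _ tT)).
- by have := W T; rewrite T0 lexx => /(_ isT); lra.
have t0 : 0 < t.
  have [t0 _] := andP tT; rewrite lt_def t0 andbT; apply/eqP => t0E.
  by apply: Wt; rewrite t0E; lra.
have ht : hi <= h t by rewrite leNgt; apply/negP.
have [e e0 eP] := continuous_gt_near (is_derive_continuous (hd _ tT))
  (lt_le_trans lohi ht).
pose r := Num.max 0 (t - e / 2).
have rt : r < t by rewrite /r gt_max t0; lra.
have r0 : 0 <= r by rewrite /r le_max lexx.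
have re : t - e / 2 <= r by rewrite /r le_max lexx orbT.
have tT' : t <= T by case/andP: tT.
have hdr s : r <= s <= t -> is_derive s 1 h (dh s).
  by move=> /andP[rs st]; apply: hd; apply/andP; split; lra.
have [c /andP[rc ct] hc] := mean_value rt hdr.
exists c; first by apply/andP; split; lra.
split.
  by apply/ltW/eP; rewrite ler0_norm; lra.
have hr : h r < hi by apply: before; rewrite r0.
rewrite leNgt; apply/negP => dc.
have : dh c * (t - r) <= 0 by rewrite mulr_le0_ge0//; lra.
lra.
Qed.

(** A triangle inequality for squares: the difference of the two sides is the
    square of 2 x - 5 y / 2. *)
Lemma sqn_near (n : nat) (x y : 'cV[R]_n) :
  sqn x <= 5 / 4 * sqn y + 5 * sqn (x - y).
Proof.
rewrite /sqn !mulr_sumr -big_split; apply: ler_sum => i _ /=.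
rewrite !mxE; set p := x i ord0; set q := y i ord0.
have : 0 <= (2 * p - 5 / 2 * q) ^+ 2 by exact: sqr_ge0.
by rewrite !expr2; lra.
Qed.

Lemma sqnB (n : nat) (x y : 'cV[R]_n) : sqn (x - y) = sqn (y - x).
Proof. by rewrite -sqnN opprB. Qed.

Lemma sqn_box_le (n : nat) (x : 'cV[R]_n) (d : R) : 0 <= d ->
  (forall i, `|x i ord0| <= d) -> sqn x <= n%:R * d ^+ 2.
Proof.
move=> d0 xd; rewrite -[leLHS]ger0_norm ?sqn_ge0//.
by apply: ler_norm_sum_ord => i; rewrite normrX ler_pXn2r// nnegrE.
Qed.

End near_region.

Section exit_time.
Variables (R : realType) (n k : nat).
Variables (A : 'cV[R]_n -> 'M[R]_n) (theta : 'cV[R]_n -> R) (C K : R).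
Hypothesis theta1 : forall x, enorm x <= 1 -> theta x = 1.
Hypothesis adm : forall rho : \bar R, (1 < rho)%E ->
  admissible k C K (truncated theta A (Ah R n k) rho).

Let admA : admissible k C K A.
Proof. exact: (adm (ltry 1)). Qed.

(** v is at most c and at least 1 / c; written so that it is monotone in c. *)
Definition pinched (c v : R) : Prop := 1 <= c * v /\ v <= c.

Lemma pinched_mono c c' v : 0 <= v -> c <= c' -> pinched c v -> pinched c' v.
Proof.
move=> v0 cc [h1 h2]; split; last exact: le_trans cc.
by apply: le_trans h1 _; rewrite ler_wpM2r.
Qed.

(** At some time t <= c of [0, T] the curve is outgoing at distance at least M,
    unless T <= c; until then its squared momentum is pinched by c. *)
Definition exits (a : 'cV[R]_n -> 'M[R]_n) (M T : R) (X Xi : R -> 'cV[R]_n)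
    (c : R) : Prop :=
  (T <= c /\ forall s, 0 <= s <= T -> pinched c (sqn (Xi s))) \/
  exists t, [/\ 0 <= t <= T, t <= c,
    M ^+ 2 <= sqn (X t) /\ 0 <= radial a (X t) (Xi t) &
    forall s, 0 <= s <= t -> pinched c (sqn (Xi s))].

Lemma exits_mono a M T X Xi c c' : c <= c' ->
  exits a M T X Xi c -> exits a M T X Xi c'.
Proof.
move=> cc [[Tc H]|[t [t0 tc out H]]]; [left|right].
  split; first exact: le_trans cc.
  by move=> s /H; apply: pinched_mono => //; exact: sqn_ge0.
exists t; split => //; first exact: le_trans cc.
by move=> s /H; apply: pinched_mono => //; exact: sqn_ge0.
Qed.

(** All curves that start close to (x0, xi0), in the ball of radius M and with
    |Xi(0)|^2 >= 1/2, exit uniformly. *)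
Lemma exit_near_point (M : R) (x0 xi0 : 'cV[R]_n) : 4 <= M ->
  nontrapping A -> xi0 != 0 ->
  exists2 d : R, 0 < d & exists c : R,
    forall (rho : \bar R) (T : R) (X Xi : R -> 'cV[R]_n),
      (1 < rho)%E -> ((2 * M)%:E < rho)%E -> 0 <= T ->
      flow_in (truncated theta A (Ah R n k) rho) [set s | 0 <= s <= T] X Xi ->
      sqn (X 0) <= M ^+ 2 -> 1 / 2 <= sqn (Xi 0) ->
      (forall i, `|X 0 i ord0 - x0 i ord0| < d) ->
      (forall i, `|Xi 0 i ord0 - xi0 i ord0| < d) ->
      exits (truncated theta A (Ah R n k) rho) M T X Xi c.
Proof.
move=> M4 nt xi0n0.
have M16 : 16 <= M ^+ 2.
  have : 0 <= (M - 4) * (M + 4) by rewrite mulr_ge0//; lra.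
  by rewrite expr2; lra.
(* The reference curve Y is followed up to its first time s1 at |Y|^2 >= m2.
   In the tube of radius 1 around it, sqn_near then gives |X(s1)|^2 >= M^2 + 1
   and |X|^2 <= 5 m2 / 4 + 5 <= (2 M)^2 until s1. *)
pose m2 := 5 / 4 * (M ^+ 2 + 5).
have m20 : 0 < m2 by rewrite /m2; lra.
have mu0 : 0 < Num.sqrt m2 by rewrite sqrtr_gt0.
have [del [Y [H [del0 [Y0 H0 flYd] [r /andP[r0 rdel] rY]]]]] := nt x0 xi0 _ xi0n0 mu0.
have flY0 : flow_in A [set s | 0 <= s <= r] Y H.
  apply: (@flow_in_sub _ _ _ [set s | - del < s < del]) flYd.
  by move=> s /= /andP[s0 sr]; apply/andP; split; lra.
have rY2 : m2 <= sqn (Y r).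
  rewrite -enorm_sqr -[m2]sqr_sqrtr; last exact: ltW.
  by rewrite ler_pXn2r// nnegrE ?enorm_ge0// ltW.
have [s1 [/andP[s10 s1r] Ys1 Ybefore]] : exists s1, [/\ 0 <= s1 <= r,
    ~ (sqn (Y s1) < m2) & forall s, 0 <= s < s1 -> sqn (Y s) < m2].
  have [|W|//] := @first_failure R (fun s => sqn (Y s) < m2) r.
    move=> t tT; exact: continuous_lt_near (is_derive_continuous
      (is_derive_sqnX flY0 tT)).
  by have := W r; rewrite lexx (ltW r0) => /(_ isT); lra.
have flY : flow_in A [set s | 0 <= s <= s1] Y H.
  apply: flow_in_sub flY0 => s /= /andP[s0 ss1].
  by rewrite s0 (le_trans ss1).
have {}Ys1 : m2 <= sqn (Y s1) by rewrite leNgt; apply/negP.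
have [b b0 Hb] : exists2 b, 0 <= b & forall s i, 0 <= s <= s1 -> `|H s i ord0| <= b.
  have cH : {within `[0, s1], continuous (fun s => sqn (H s))}.
    apply: within_continuous => s ss1.
    exact: is_derive_continuous (is_derive_sqnXi flY ss1).
  have [c _ cP] := EVT_max s10 cH.
  exists (Num.sqrt (sqn (H c))); first exact: sqrtr_ge0.
  move=> s i ss1; apply: le_trans (coord_le _ _) _.
  by apply: ler_wsqrtr; apply: cP; rewrite in_itv.
pose L := b + 1.
have L0 : 0 <= L by rewrite /L; lra.
pose G := 4 * n%:R * field_lip n C K L.
have G0 : 0 <= G by rewrite /G !mulr_ge0// (field_lip_ge0 admA).
pose E := expR (G * s1).
have E1 : 1 <= E.
  by rewrite /E; apply: le_trans (expR_ge1Dx _); rewrite lerDl mulr_ge0.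
(* so small that the Gronwall factor E keeps the distance below 1 / 2 *)
pose d := (2 * (n%:R + 1) * E)^-1.
have n0 : 0 <= n%:R :> R by [].
have nE : 1 <= (n%:R + 1) * E.
  by rewrite -[leLHS]mulr1; apply: ler_pM => //; move: n0;
    clear -adm admA theta1; lra.
have dE0 : 0 < 2 * (n%:R + 1) * E by rewrite -mulrA; move: nE;
  clear -adm admA theta1; lra.
have d0 : 0 < d by rewrite invr_gt0.
have d12 : d <= 1 / 2.
  rewrite /d mul1r lef_pV2 ?posrE// -mulrA; move: nE; clear -adm admA theta1; lra.
have dE : (n%:R * d ^+ 2 + n%:R * d ^+ 2) * E <= 1 / 2.
  have dd : d * (2 * (n%:R + 1) * E) = 1 by rewrite /d mulVf// lt0r_neq0.
  have dEE : 0 <= 2 * d * E by rewrite !mulr_ge0 ?(ltW d0)//; move: E1;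
    clear -adm admA theta1; lra.
  have h1 : 2 * n%:R * d * E <= 1 by move: dd dEE; clear -adm admA theta1; lra.
  have := ler_wpM2l (ltW d0) h1; rewrite expr2; move: d12;
    clear -adm admA theta1; lra.
pose kap := 2 * n%:R ^+ 3 * C * Num.sqrt (n%:R * L ^+ 2).
have kap0 : 0 <= kap.
  by rewrite /kap !mulr_ge0 ?exprn_ge0 ?sqrtr_ge0// (adm_C admA).
pose F := expR (kap * s1).
exists d => //; exists (s1 + n%:R * L ^+ 2 + 2 * F).
set c := s1 + _ + _.
have F0 : 0 <= F by exact: expR_ge0.
have nL0 : 0 <= n%:R * L ^+ 2 by rewrite mulr_ge0// sqr_ge0.
move=> rho T X Xi rho1 rhoM T0 flX X0M Xi0 X0x Xi0xi.
pose tau := Num.min T s1.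
have tau0 : 0 <= tau by rewrite le_min T0.
have tauT : tau <= T by rewrite ge_min lexx.
have taus1 : tau <= s1 by rewrite ge_min lexx orbT.
pose S s := sqdist (X s) (Xi s) (Y s) (H s).
have S0 : S 0 <= n%:R * d ^+ 2 + n%:R * d ^+ 2.
  by apply: lerD; apply: sqn_box_le => [|i]; rewrite ?(ltW d0)// !mxE ltW// ?Y0 ?H0.
have S012 : S 0 <= 1 / 2.
  have S00 : 0 <= S 0 by rewrite addr_ge0// sqn_ge0.
  apply: le_trans dE; apply: le_trans S0 _; rewrite ler_peMr//.
  by rewrite addr_ge0// mulr_ge0// sqr_ge0.
have SXY s : sqn (X s - Y s) <= S s by rewrite lerDl sqn_ge0.
(* if s1 were 0 then Y(0), hence X(0), would lie outside the ball of radius M *)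
have s1pos : 0 < s1.
  rewrite lt_def s10 andbT; apply/eqP => s1E; move: Ys1; rewrite s1E.
  move: (sqn_near (Y 0) (X 0)) (SXY 0) X0M S012; rewrite sqnB /m2;
    clear -adm admA theta1; lra.
have Yle s : 0 <= s <= s1 -> sqn (Y s) <= m2.
  move=> /andP[s0]; rewrite le_eqVlt => /predU1P[->|ss1]; last first.
    by apply/ltW/Ybefore; rewrite s0.
  apply: (@continuous_le_left _ (fun s => sqn (Y s)) s1 m2 0) => //.
    apply: is_derive_continuous (is_derive_sqnX flY _) => /=.
    by rewrite s10 lexx.
  by move=> s' /Ybefore/ltW.
have flXt : flow_in (truncated theta A (Ah R n k) rho) [set s | 0 <= s <= tau] X Xi.
  by apply: flow_in_sub flX => s /= /andP[s0 st]; rewrite s0 (le_trans st).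
have flYt : flow_in A [set s | 0 <= s <= tau] Y H.
  by apply: flow_in_sub flY => s /= /andP[s0 st]; rewrite s0 (le_trans st).
have Sc s : 0 <= s <= tau -> {for s, continuous S}.
  move=> st; exact: is_derive_continuous (is_derive_sqdist flXt flYt st).
have XiL s : 0 <= s <= tau -> S s <= 1 -> forall i, `|Xi s i ord0| <= L.
  move=> /andP[s0 st] Ss1 i.
  have h1 : `|H s i ord0| <= b by apply: Hb; rewrite s0 (le_trans st).
  have h2 : `|Xi s i ord0 - H s i ord0| <= 1.
    rewrite -(@ler_pXn2r _ 2)// ?nnegrE// real_normK ?num_real// expr1n.
    apply: le_trans Ss1; have := sqr_coord_le (Xi s - H s) i; rewrite !mxE.
    by move=> /le_trans; apply; rewrite lerDr sqn_ge0.
  have -> : Xi s i ord0 = (Xi s i ord0 - H s i ord0) + H s i ord0 by ring.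
  by apply: le_trans (ler_normD _ _) _; rewrite /L addrC lerD.
(* the curve stays in the tube of radius 1 around the reference curve *)
have tube s : 0 <= s <= tau -> S s < 1.
  have [|W|[t [/andP[t0 tT] Wt before]]] := @first_failure R (fun s => S s < 1) tau.
  - by move=> t tT; exact: continuous_lt_near (Sc t tT).
  - exact: W.
  exfalso; apply: Wt.
  have tin : 0 <= t <= tau by rewrite t0 tT.
  have St s' : 0 <= s' <= t -> S s' <= 1.
    move=> /andP[s'0]; rewrite le_eqVlt => /predU1P[->|st]; last first.
      by apply/ltW/before; rewrite s'0.
    move: t0; rewrite le_eqVlt => /predU1P[<-|t0].
      by move: S012; clear -adm admA theta1; lra.
    by apply: (continuous_le_left (Sc _ tin) t0) => r' /before/ltW.
  have sub s' : 0 <= s' <= t -> 0 <= s' <= tau.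
    by move=> /andP[-> st] /=; rewrite (le_trans st).
  have flXA : flow_in A [set s | 0 <= s <= t] X Xi.
    apply: (flow_in_truncated theta1 (adm_derivable admA) rho1 (rho := rho) (k := k)).
      move=> s' /= s't; apply: le_lt_trans rhoM; rewrite lee_fin.
      rewrite -(@ler_pXn2r _ 2)// ?nnegrE ?enorm_ge0//; last first.
        by move: M4; clear -adm admA theta1; lra.
      rewrite enorm_sqr exprMn; have := sqn_near (X s') (Y s').
      have := SXY s'; have := St s' s't; have := Yle s'.
      have /andP[-> st'] := sub s' s't; rewrite (le_trans st' taus1) => /(_ isT).
      by move: M16; rewrite /m2; clear -adm admA theta1; lra.
    by apply: flow_in_sub flXt => s' /= /sub.
  have flYA : flow_in A [set s | 0 <= s <= t] Y H.
    by apply: flow_in_sub flYt => s' /= /sub.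
  have := @flow_gronwall R n k C K A admA X Xi Y H t L L0 flXA flYA _ _ t0.
  rewrite -/(S t) -/(S 0) -/G => gr.
  have {}gr : S t <= S 0 * expR (G * t).
    apply: gr => s' i s't; first by apply: XiL; [exact: sub|exact: St].
    apply: le_trans (Hb _ _ _) _; last by rewrite /L lerDl.
    by have /andP[-> st'] := sub s' s't; rewrite (le_trans st' taus1).
  apply: le_lt_trans gr _; apply: (@le_lt_trans _ _ (1 / 2)); last first.
    by clear -adm admA theta1; lra.
  apply: le_trans dE; apply: ler_pM => //.
  - by rewrite addr_ge0// sqn_ge0.
  - by rewrite /E ler_expR ler_wpM2l// (le_trans tT).
have vup s : 0 <= s <= tau -> sqn (Xi s) <= n%:R * L ^+ 2.
  move=> st; apply: sqn_box_le => //; apply: XiL => //.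
  by apply/ltW/tube.
have pin s : 0 <= s <= tau -> pinched c (sqn (Xi s)).
  move=> st; have [s0 st'] := andP st; split; last first.
    by apply: le_trans (vup s st) _; rewrite /c; move: s10 F0;
      clear -adm admA theta1; lra.
  have sub : [set r | 0 <= r <= s] `<=` [set r : R | 0 <= r <= tau].
    by move=> r' /= /andP[-> rs] /=; rewrite (le_trans rs).
  have := @momentum_lower_bound R n k C K _ (adm rho1) X Xi s (n%:R * L ^+ 2) s0
    (flow_in_sub sub flXt) (fun r' rs => vup r' (sub r' rs)).
  rewrite -/kap => low.
  have : expR (kap * s) <= F.
    by rewrite /F ler_expR ler_wpM2l// (le_trans st').
  move=> /(ler_wpM2l (sqn_ge0 (Xi s))) h1.
  have h2 : 0 <= (s1 + n%:R * L ^+ 2) * sqn (Xi s).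
    by rewrite mulr_ge0 ?sqn_ge0// addr_ge0.
  have -> : c * sqn (Xi s) = (s1 + n%:R * L ^+ 2) * sqn (Xi s) +
    2 * (sqn (Xi s) * F) by rewrite /c; ring.
  by move: Xi0 low h1 h2; clear -adm admA theta1; lra.
have [Ts1|s1T] := leP T s1.
  have tauE : tau = T by rewrite /tau min_l.
  left; split; last by rewrite tauE in pin.
  by rewrite /c; move: Ts1 nL0 F0; clear -adm admA theta1; lra.
have tauE : tau = s1 by rewrite /tau min_r// ltW.
have Xs1 : M ^+ 2 + 1 <= sqn (X s1).
  have := sqn_near (Y s1) (X s1); have := SXY s1; rewrite sqnB.
  have := tube s1; rewrite tauE s10 lexx => /(_ isT).
  by move: Ys1; rewrite /m2; clear -adm admA theta1; lra.
rewrite tauE in flXt pin.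
have [t /andP[t0 ts1] out] := @upcrossing R (fun s => sqn (X s)) _ s1 (M ^+ 2)
  (M ^+ 2 + 1) ltac:(by rewrite ltrDl) s10 (fun s ss => is_derive_sqnX flXt ss) X0M Xs1.
right; exists t; split => //.
- by rewrite t0 (le_trans ts1)// ltW.
- by rewrite /c; move: ts1 nL0 F0; clear -adm admA theta1; lra.
- by move=> s /andP[s0 st]; apply: pin; rewrite s0 (le_trans st).
Qed.

(** Uniform exit from the ball of radius M, by compactness of the set of data
    with |x| <= M and 1/2 <= |xi|^2 <= 2. *)
Lemma uniform_exit (M : R) : 4 <= M -> nontrapping A ->
  exists c : R, forall (rho : \bar R) (T : R) (X Xi : R -> 'cV[R]_n),
    (1 < rho)%E -> ((2 * M)%:E < rho)%E -> 0 <= T ->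
    flow_in (truncated theta A (Ah R n k) rho) [set s | 0 <= s <= T] X Xi ->
    sqn (X 0) <= M ^+ 2 -> 1 / 2 <= sqn (Xi 0) <= 2 ->
    exits (truncated theta A (Ah R n k) rho) M T X Xi c.
Proof.
move=> M4 nt.
pose Q (w : 'rV[R]_(n + n)) (c : R) :=
  forall (rho : \bar R) (T : R) (X Xi : R -> 'cV[R]_n),
    (1 < rho)%E -> ((2 * M)%:E < rho)%E -> 0 <= T ->
    flow_in (truncated theta A (Ah R n k) rho) [set s | 0 <= s <= T] X Xi ->
    sqn (X 0) <= M ^+ 2 -> 1 / 2 <= sqn (Xi 0) ->
    X 0 = (lsubmx w)^T -> Xi 0 = (rsubmx w)^T ->
    exits (truncated theta A (Ah R n k) rho) M T X Xi c.
have [||c cP] := @box_uniform_bound R (n + n) M Q.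
- move=> w c c' cc Qw rho T X Xi *; apply: exits_mono cc _; exact: Qw.
- move=> z _; pose x0 := (lsubmx z)^T; pose xi0 := (rsubmx z)^T.
  have lE (w : 'rV[R]_(n + n)) i : ((lsubmx w)^T : 'cV_n) i ord0 = w ord0 (lshift n i).
    by rewrite !mxE ord1.
  have rE (w : 'rV[R]_(n + n)) i : ((rsubmx w)^T : 'cV_n) i ord0 = w ord0 (rshift n i).
    by rewrite !mxE ord1.
  have [xi00|xi0n0] := eqVneq xi0 0; last first.
    have [d d0 [c cP]] := exit_near_point x0 M4 nt xi0n0.
    exists d => //; exists c => w _ wz rho T X Xi r1 rM T0 fl XM Xi2 X0 Xi0.
    apply: cP => // i.
    + by rewrite X0 /x0 !lE.
    + by rewrite Xi0 /xi0 !rE.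
  (* no admissible momentum lies near 0 *)
  pose d : R := (2 * (n%:R + 1))^-1.
  have n0 : 0 <= n%:R :> R by [].
  have d0 : 0 < d by rewrite invr_gt0; lra.
  have dd : d * (2 * (n%:R + 1)) = 1 by rewrite /d mulVf// lt0r_neq0//; lra.
  exists d => //; exists 0 => w _ wz rho T X Xi _ _ _ _ _ Xi2 _ Xi0.
  have : sqn (Xi 0) <= n%:R * d ^+ 2.
    apply: sqn_box_le; first exact: ltW.
    move=> i; have := wz (rshift n i); rewrite Xi0 rE => /ltW.
    by rewrite -(rE z) -/xi0 xi00 mxE subr0.
  have h1 : n%:R * d <= 1 / 2 by lra.
  have := ler_wpM2r (ltW d0) h1.
  have nd : 0 <= n%:R * d by rewrite mulr_ge0// ltW.
  by rewrite expr2; lra.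
exists c => rho T X Xi rho1 rhoM T0 fl XM /andP[Xi1 Xi2].
have e1 : (lsubmx (row_mx (X 0)^T (Xi 0)^T))^T = X 0 by rewrite row_mxKl trmxK.
have e2 : (rsubmx (row_mx (X 0)^T (Xi 0)^T))^T = Xi 0 by rewrite row_mxKr trmxK.
have M0 : 0 <= M by lra.
apply: (cP (row_mx (X 0)^T (Xi 0)^T)) => // i.
rewrite mxE; case: (fintype.split i) => j; rewrite mxE.
- rewrite -(@ler_pXn2r _ 2)// ?nnegrE// real_normK ?num_real//.
  exact: le_trans (sqr_coord_le _ _) XM.
- rewrite -(@ler_pXn2r _ 2)// ?nnegrE// real_normK ?num_real//.
  apply: le_trans (sqr_coord_le _ _) (le_trans Xi2 _).
  have : 4 * 4 <= M * M by apply: ler_pM.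
  by rewrite expr2; lra.
Qed.

End exit_time.

(** * A priori bounds and completeness *)

Section a_priori_bounds.
Variables (R : realType) (n k : nat) (a : 'cV[R]_n -> 'M[R]_n) (C K c : R).
Hypothesis adm : admissible k C K a.
Implicit Types (X Xi : R -> 'cV[R]_n) (s t T : R).

Let M := far_radius n C.

Lemma flow_momentum_pos X Xi T : 0 <= T ->
  flow_in a [set s | 0 <= s <= T] X Xi -> 0 < sqn (Xi 0) -> 0 < sqn (Xi T).
Proof.
move=> T0 fl v0.
have cv : {within `[0, T], continuous (fun s => sqn (Xi s))}.
  apply: within_continuous => s sT.
  exact: is_derive_continuous (is_derive_sqnXi fl sT).
have [m _ mP] := EVT_max T0 cv.
have bd s : 0 <= s <= T -> sqn (Xi s) <= sqn (Xi m).
  by move=> sT; apply: mP; rewrite in_itv.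
have := momentum_lower_bound adm T0 fl bd.
rewrite lt_def sqn_ge0 andbT; apply: contraTneq => ->.
by rewrite mul0r -ltNge.
Qed.

(** The escape estimate from an arbitrary initial time t. *)
Lemma escape_from X Xi T t : flow_in a [set s | 0 <= s <= T] X Xi ->
  0 <= t <= T -> M ^+ 2 <= sqn (X t) -> 0 <= radial a (X t) (Xi t) ->
  0 < sqn (Xi t) -> forall s, t <= s <= T ->
    sqn (X t) + sqn (Xi t) / 2 * (s - t) ^+ 2 <= sqn (X s) /\
    sqn (Xi t) / 2 <= sqn (Xi s) <= 3 / 2 * sqn (Xi t).
Proof.
move=> fl /andP[t0 tT] Mt rt vt s /andP[ts sT].
have fl' : flow_in a [set r | 0 <= r <= T - t]
    (fun r => X (t + r)) (fun r => Xi (t + r)).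
  apply: (flow_in_sub _ (flow_in_shift (c := t) fl)) => r /= /andP[r0 rT].
  by apply/andP; split; lra.
have := @flow_escape R n k C K a adm _ _ (T - t) fl'.
rewrite addr0 => /(_ Mt rt vt (s - t)).
have -> : t + (s - t) = s by ring.
by apply; apply/andP; split; lra.
Qed.

(** The escape estimate for the reversed curve. *)
Lemma escape_backwards X Xi T : 0 <= T ->
  flow_in a [set s | 0 <= s <= T] X Xi ->
  M ^+ 2 <= sqn (X T) -> radial a (X T) (Xi T) <= 0 ->
  0 < sqn (Xi T) -> forall s, 0 <= s <= T ->
    sqn (X T) + sqn (Xi T) / 2 * (T - s) ^+ 2 <= sqn (X s) /\
    sqn (Xi T) / 2 <= sqn (Xi s) <= 3 / 2 * sqn (Xi T).
Proof.
move=> T0 fl MT rT vT s /andP[s0 sT].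
have fl' : flow_in a [set r | 0 <= r <= T]
    (fun r => X (T - r)) (fun r => - Xi (T - r)).
  apply: (flow_in_sub _ (flow_in_reverse (c := T) fl)) => r /= /andP[r0 rT'].
  by apply/andP; split; lra.
have := @flow_escape R n k C K a adm _ _ T fl'.
rewrite subr0 radial_opp oppr_ge0 sqnN => /(_ MT rT vT (T - s)).
rewrite sqnN subKr; apply.
by apply/andP; split; lra.
Qed.

(** Follow the curve until it becomes outgoing at distance at least M or enters
    the ball of radius M, and at most until T: up to that time it is, backwards,
    an escaping curve. *)
Lemma incoming_phase X Xi T : 0 <= T ->
  flow_in a [set s | 0 <= s <= T] X Xi -> sqn (Xi 0) = 1 ->
  exists tau, [/\ 0 <= tau <= T,
    2 / 3 <= sqn (Xi tau) <= 2,
    forall s, 0 <= s <= tau ->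
      (tau - s) ^+ 2 / 4 <= sqn (X s) /\ 1 / 3 <= sqn (Xi s) <= 3 &
    [\/ tau = T, M ^+ 2 <= sqn (X tau) /\ 0 <= radial a (X tau) (Xi tau)
      | sqn (X tau) <= M ^+ 2]].
Proof.
move=> T0 fl v0.
have back tau : 0 <= tau <= T -> M ^+ 2 <= sqn (X tau) ->
    radial a (X tau) (Xi tau) <= 0 ->
    2 / 3 <= sqn (Xi tau) <= 2 /\ forall s, 0 <= s <= tau ->
      (tau - s) ^+ 2 / 4 <= sqn (X s) /\ 1 / 3 <= sqn (Xi s) <= 3.
  move=> /andP[tau0 tauT] Mtau rtau.
  have flt : flow_in a [set s | 0 <= s <= tau] X Xi.
    by apply: flow_in_sub fl => s /= /andP[s0 st]; rewrite s0 (le_trans st).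
  have vtau : 0 < sqn (Xi tau) by apply: flow_momentum_pos flt _ => //; rewrite v0.
  have esc := escape_backwards tau0 flt Mtau rtau vtau.
  have [_ /andP[v1 v2]] : _ /\ _ := esc 0 ltac:(by rewrite lexx tau0).
  rewrite v0 in v1 v2.
  split; first by apply/andP; split; lra.
  move=> s st; have [h1 /andP[h2 h3]] := esc s st; split; last first.
    by apply/andP; split; lra.
  have q0 : 0 <= (tau - s) ^+ 2 by exact: sqr_ge0.
  have : 1 / 4 * (tau - s) ^+ 2 <= sqn (Xi tau) / 2 * (tau - s) ^+ 2.
    by apply: ler_wpM2r => //; lra.
  by have := sqn_ge0 (X tau); lra.
have at0 : 2 / 3 <= sqn (Xi 0) <= 2 /\ forall s, 0 <= s <= 0 ->
    (0 - s) ^+ 2 / 4 <= sqn (X s) /\ 1 / 3 <= sqn (Xi s) <= 3.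
  rewrite v0; split; first by apply/andP; split; lra.
  move=> s s0; have -> : s = 0 by apply/eqP; rewrite eq_sym eq_le.
  rewrite subrr expr0n/= mul0r v0; split; first exact: sqn_ge0.
  by apply/andP; split; lra.
have [h0|h0] := leP (sqn (X 0)) (M ^+ 2).
  exists 0; rewrite lexx T0; split; [by []|exact: at0.1|exact: at0.2|].
  by apply: Or33.
have hc s : 0 <= s <= T -> {for s, continuous (fun s => sqn (X s))}.
  by move=> sT; exact: is_derive_continuous (is_derive_sqnX fl sT).
have gc s : 0 <= s <= T -> {for s, continuous (fun s => radial a (X s) (Xi s))}.
  move=> sT; exact: is_derive_continuous (is_derive_radial fl
    (adm_derivable adm) (adm_dlip adm) sT).
have [|W|[tau [tauT Wt before]]] := @first_failure R
  (fun s => M ^+ 2 < sqn (X s) /\ radial a (X s) (Xi s) < 0) T.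
- move=> t tT [w1 w2].
  have [e1 e10 P1] := continuous_gt_near (hc t tT) w1.
  have [e2 e20 P2] := continuous_lt_near (gc t tT) w2.
  exists (Num.min e1 e2); first by rewrite lt_min e10.
  by move=> s; rewrite lt_min => /andP[s1 s2]; split; [exact: P1|exact: P2].
- have TT : 0 <= T <= T by rewrite T0 lexx.
  have [w1 w2] := W T TT; have [b1 b2] := back T TT (ltW w1) (ltW w2).
  by exists T; split => //; apply: Or31.
have [tau0 tauT'] := andP tauT.
have [tauE|tau_neq0] := eqVneq tau 0.
  exists 0; rewrite lexx T0; split; [by []|exact: at0.1|exact: at0.2|].
  apply: Or32; split; first exact: ltW.
  by rewrite leNgt; apply/negP => r0; apply: Wt; rewrite tauE.
have taupos : 0 < tau by rewrite lt_def tau_neq0.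
have Mtau : M ^+ 2 <= sqn (X tau).
  by apply: (continuous_ge_left (hc _ tauT) taupos) => s /before[/ltW].
have rtau : radial a (X tau) (Xi tau) <= 0.
  by apply: (continuous_le_left (gc _ tauT) taupos) => s /before[_ /ltW].
have [b1 b2] := back tau tauT Mtau rtau.
exists tau; split => //.
have [r0|r0] := leP 0 (radial a (X tau) (Xi tau)); first by apply: Or32.
by apply: Or33; rewrite leNgt; apply/negP => Mt; apply: Wt.
Qed.

Hypothesis c0 : 0 <= c.
(* the conclusion of uniform_exit for the symbol a *)
Hypothesis near_exit : forall (T : R) (X Xi : R -> 'cV[R]_n), 0 <= T ->
  flow_in a [set s | 0 <= s <= T] X Xi ->
  sqn (X 0) <= M ^+ 2 -> 1 / 2 <= sqn (Xi 0) <= 2 -> exits a M T X Xi c.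

(** The three phases together: incoming up to tau, then at most c units of
    time near the ball of radius M, then escape. *)
Lemma a_priori X Xi T : 0 <= T ->
  flow_in a [set s | 0 <= s <= T] X Xi -> sqn (Xi 0) = 1 ->
  exists tau, [/\ 0 <= tau <= T,
    forall s, 0 <= s <= tau -> (tau - s) ^+ 2 / 4 <= sqn (X s),
    forall s, 0 <= s <= T -> pinched (2 * c + 3) (sqn (Xi s)) &
    T <= tau + c \/ exists t, [/\ 0 <= t <= T, t <= tau + c,
      M ^+ 2 <= sqn (X t) & 0 <= radial a (X t) (Xi t)]].
Proof.
move=> T0 fl v0; have c0' := c0.
have [tau [tauT /andP[vt1 vt2] inc out]] := incoming_phase T0 fl v0.
have [tau0 tauT'] := andP tauT.
have incp s : 0 <= s <= tau -> pinched (2 * c + 3) (sqn (Xi s)).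
  move=> /inc[_ /andP[v1 v2]]; split; last by lra.
  by have := mulr_ge0 c0 (sqn_ge0 (Xi s)); lra.
have pos s : 0 <= s <= T -> 0 < sqn (Xi s).
  move=> /andP[s0 sT]; apply: (@flow_momentum_pos X Xi s s0); last by rewrite v0.
  by apply: flow_in_sub fl => r /= /andP[-> rs] /=; rewrite (le_trans rs).
exists tau; split => //.
- by move=> s /inc[].
- move=> s /andP[s0 sT]; have [st|/ltW ts] := leP s tau.
    by apply: incp; rewrite s0.
  have sT' : 0 <= s <= T by rewrite s0.
  case: out => [tauE|[Mt rt]|nt].
  + by apply: incp; rewrite s0 tauE.
  + have [_ /andP[v1 v2]] := escape_from fl tauT Mt rt (pos _ tauT)
      (s := s) ltac:(by rewrite ts sT).
    split; last by lra.
    by have := mulr_ge0 c0 (sqn_ge0 (Xi s)); lra.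
  have fl' : flow_in a [set r | 0 <= r <= T - tau]
      (fun r => X (tau + r)) (fun r => Xi (tau + r)).
    apply: (flow_in_sub _ (flow_in_shift (c := tau) fl)) => r /= /andP[r0 rT].
    by apply/andP; split; lra.
  have := near_exit (T := T - tau) _ fl'; rewrite addr0.
  case=> //; first by lra.
  * by apply/andP; split; lra.
  * move=> [_ H]; have := H (s - tau); have -> : tau + (s - tau) = s by ring.
    case; first by apply/andP; split; lra.
    move=> p1 p2; apply: (@pinched_mono _ c); [exact: sqn_ge0|lra|by split].
  * move=> [t [/andP[t0 tT] tc [Mt rt] H]].
    have [st|/ltW ts'] := leP s (tau + t).
      have := H (s - tau); have -> : tau + (s - tau) = s by ring.
      case; first by apply/andP; split; lra.
      move=> p1 p2; apply: (@pinched_mono _ c); [exact: sqn_ge0|lra|by split].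
    have tt : 0 <= tau + t <= T by apply/andP; split; lra.
    have [_ /andP[v1 v2]] := escape_from fl tt Mt rt (pos _ tt)
      (s := s) ltac:(by rewrite ts' sT).
    have [p1 p2] := H t ltac:(by rewrite t0 lexx).
    split; last by lra.
    have : c * sqn (Xi (tau + t)) <= c * (2 * sqn (Xi s)).
      by apply: ler_wpM2l => //; lra.
    by have := sqn_ge0 (Xi s); lra.
- case: out => [->|[Mt rt]|nt]; first by left; lra.
    by right; exists tau; split => //; lra.
  have fl' : flow_in a [set r | 0 <= r <= T - tau]
      (fun r => X (tau + r)) (fun r => Xi (tau + r)).
    apply: (flow_in_sub _ (flow_in_shift (c := tau) fl)) => r /= /andP[r0 rT].
    by apply/andP; split; lra.
  have := near_exit (T := T - tau) _ fl'; rewrite addr0.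
  case=> //; first by lra.
  + by apply/andP; split; lra.
  + by move=> [Tc _]; left; lra.
  + move=> [t [/andP[t0 tT] tc [Mt rt] _]]; right; exists (tau + t); split => //.
      by apply/andP; split; lra.
    by lra.
Qed.

Lemma momentum_pinched X Xi T : 0 <= T ->
  flow_in a [set s | 0 <= s <= T] X Xi -> sqn (Xi 0) = 1 ->
  pinched (2 * c + 3) (sqn (Xi T)).
Proof.
by move=> T0 fl v0; have [tau [_ _ H _]] := a_priori T0 fl v0;
  apply: H; rewrite T0 lexx.
Qed.

Lemma clamp_opp L t : 0 <= L -> clamp L (- t) = - clamp L t.
Proof.
by move=> L0; rewrite /clamp oppr_max oppr_min opprK maxEle !minEle;
  case: (leP L t) => h1; case: (leP L (- t)) => h2; repeat case: ifPn;
  rewrite ?maxEle; repeat case: ifPn; rewrite -?ltNge => *; lra.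
Qed.

(** The truncation of momenta in clamped_flow is never active, so the flow is
    complete. *)
Lemma complete_flow (x xi : 'cV[R]_n) : sqn xi = 1 ->
  exists X Xi, [/\ X 0 = x, Xi 0 = xi & flow_in a setT X Xi].
Proof.
move=> xi1; have c0' := c0; pose L := 2 * c + 4.
have L0 : 0 <= L by rewrite /L; lra.
pose cl X Xi := forall (s : R) (j : 'I_n),
      is_derive s 1 (fun t => X t j ord0)
        (velX a (X s) (\col_i clamp L (Xi s i ord0)) j) /\
      is_derive s 1 (fun t => Xi t j ord0)
        (velXi a (X s) (\col_i clamp L (Xi s i ord0)) j).
have cl_flow X Xi (D : set R) : cl X Xi ->
    (forall s, D s -> sqn (Xi s) <= L ^+ 2) -> flow_in a D X Xi.
  move=> XXi small s Ds j; have := XXi s j.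
  have -> // : \col_i clamp L (Xi s i ord0) = Xi s.
  apply/colP => i; rewrite mxE clamp_id//.
  rewrite -(@ler_pXn2r _ 2)// ?nnegrE// real_normK ?num_real//.
  exact: le_trans (sqr_coord_le _ _) (small s Ds).
have cl_small X Xi : cl X Xi -> sqn (Xi 0) = 1 ->
    forall T, 0 <= T -> sqn (Xi T) <= L ^+ 2.
  move=> XXi v0 T T0.
  have L2 : 2 * c + 3 < L ^+ 2.
    have : 0 <= c * c by rewrite mulr_ge0.
    by rewrite /L expr2; lra.
  have vc s : {for s, continuous (fun s => sqn (Xi s))}.
    apply: (@is_derive_continuous _ _ _ (\sum_(j < n) 2 * Xi s j ord0 *
      velXi a (X s) (\col_i clamp L (Xi s i ord0)) j)).
    apply: (is_derive_bigsum _ (F := fun j t => Xi t j ord0 ^+ 2)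
      (dF := fun j t => 2 * Xi t j ord0 *
         velXi a (X t) (\col_i clamp L (Xi t i ord0)) j)).
    by move=> j; exact: is_derive_sqr (XXi s j).2.
  have [|W|[t [/andP[t0 tT] Wt before]]] := @first_failure R
    (fun s => sqn (Xi s) < L ^+ 2) T.
  - by move=> t _; exact: continuous_lt_near (vc t).
  - by apply/ltW/W; rewrite T0 lexx.
  exfalso; apply: Wt; apply: le_lt_trans L2.
  suff fl : flow_in a [set s | 0 <= s <= t] X Xi.
    exact: (momentum_pinched t0 fl v0).2.
  apply: cl_flow => // s /= /andP[s0]; rewrite le_eqVlt => /predU1P[->|st].
    move: t0; rewrite le_eqVlt => /predU1P[<-|t0].
      by rewrite v0 -(expr1n _ 2) ler_pXn2r ?nnegrE//; rewrite /L; lra.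
    by apply: (continuous_le_left (vc t) t0) => r /before/ltW.
  by apply/ltW/before; rewrite s0.
have [X [Xi [X0 Xi0 XXi]]] := clamped_flow adm x xi L0.
exists X, Xi; split => //; apply: cl_flow => // s _.
have [s0|s0] := leP 0 s; first by apply: cl_small XXi _ _ s0; rewrite Xi0.
have rev : cl (fun r => X (0 - r)) (fun r => - Xi (0 - r)).
  move=> r j.
  have -> : \col_i clamp L ((- Xi (0 - r)) i ord0) =
      - \col_i clamp L (Xi (0 - r) i ord0).
    by apply/colP => i; rewrite !mxE clamp_opp.
  have [d1 d2] := XXi (0 - r) j.
  rewrite velX_opp velXi_opp; split; first exact: is_derive_reverse d1.
  rewrite -[velXi _ _ _ _]opprK; under eq_fun do rewrite mxE.
  exact: is_derive_opp (is_derive_reverse d2).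
have v0 : sqn (- Xi (0 - 0)) = 1 by rewrite sqnN subr0 Xi0.
have s0' : 0 <= - s by lra.
by have := cl_small _ _ rev v0 (- s) s0'; rewrite sqnN sub0r opprK.
Qed.

End a_priori_bounds.

(** * Outgoing times and time spent in dyadic shells *)

Section outgoing_times.
Variables (R : realType) (n : nat) (a : 'cV[R]_n -> 'M[R]_n) (C K : R) (k : nat).
Hypothesis adm : admissible k C K a.
Variables X Xi : R -> 'cV[R]_n.
Hypothesis fl : flow_in a setT X Xi.

(** The predicate outgoing in terms of squared norms. *)
Lemma outgoingE (M : R) s : 0 <= M ->
  outgoing M X s <-> 0 <= radial a (X s) (Xi s) /\ M ^+ 2 <= sqn (X s).
Proof.
move=> M0; rewrite /outgoing.
have -> : (fun t => enorm (X t) ^+ 2) = (fun t => sqn (X t)).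
  by apply/funext => t; rewrite enorm_sqr.
have [_ rE] := is_derive_sqnX fl (I : setT s).
rewrite derive1E rE -enorm_sqr.
by split=> -[h1 h2]; split => //; move: h2; rewrite ler_pXn2r// nnegrE enorm_ge0.
Qed.

(** The infimum of the outgoing times is outgoing. *)
Lemma first_outgoing_time (M : R) : 0 <= M ->
  let E := [set s : R | 0 <= s /\ outgoing M X s] in
  E !=set0 -> 0 <= inf E /\ outgoing M X (inf E).
Proof.
move=> M0 E E0.
have lbE : lbound E 0 by move=> s [].
have hE : has_inf E by split => //; exists 0.
have i0 : 0 <= inf E by exact: lb_le_inf.
split=> //; apply/outgoingE => //; split.
- rewrite leNgt; apply/negP => r0.
  have rc := is_derive_continuous (is_derive_radial fl (adm_derivable adm)
    (adm_dlip adm) (I : setT (inf E))).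
  have [e e0 eP] := continuous_lt_near rc r0.
  have [s Es se] := inf_adherent e0 hE.
  have iEs : inf E <= s by apply: ge_inf => //; case: hE.
  have /outgoingE [//|rs _] := Es.2.
  have : radial a (X s) (Xi s) < 0.
    by apply: eP; rewrite ger0_norm ?subr_ge0//; lra.
  lra.
- rewrite leNgt; apply/negP => h0.
  have hc := is_derive_continuous (is_derive_sqnX fl (I : setT (inf E))).
  have [e e0 eP] := continuous_lt_near hc h0.
  have [s Es se] := inf_adherent e0 hE.
  have iEs : inf E <= s by apply: ge_inf => //; case: hE.
  have /outgoingE [//|_ hs] := Es.2.
  have : sqn (X s) < M ^+ 2.
    by apply: eP; rewrite ger0_norm ?subr_ge0//; lra.
  lra.
Qed.

End outgoing_times.

Lemma pinched_enorm (R : realType) (n : nat) (c : R) (x : 'cV[R]_n) : 1 <= c ->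
  pinched c (sqn x) -> c^-1 <= enorm x <= c.
Proof.
move=> c1 [h1 h2]; have c0 : 0 < c by lra.
have cc : c <= c ^+ 2 by rewrite expr2 ler_peMl// ltW.
apply/andP; split.
- rewrite -(@ler_pXn2r _ 2)// ?nnegrE ?enorm_ge0 ?invr_ge0 ?(ltW c0)//.
  rewrite enorm_sqr exprVn -[leLHS]mul1r ler_pdivrMr ?exprn_gt0// mulrC.
  by apply: le_trans h1 _; apply: ler_wpM2r => //; exact: sqn_ge0.
- rewrite -(@ler_pXn2r _ 2)// ?nnegrE ?enorm_ge0 ?(ltW c0)//.
  by rewrite enorm_sqr; exact: le_trans cc.
Qed.

Lemma lebesgue_measure_sub_segment (R : realType) (I : set R) (u v l : R) :
  I `<=` `[u, v] -> v - u <= l -> 0 <= l -> measurable I ->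
  (lebesgue_measure I <= l%:E)%E.
Proof.
move=> Iuv uvl l0 mI.
have mJ : measurable `[u, v]%classic by exact: measurable_itv.
apply: (@le_trans _ _ (lebesgue_measure `[u, v]%classic)).
  exact: (@le_measure _ _ _ lebesgue_measure _ _ (mem_set mI) (mem_set mJ) Iuv).
rewrite lebesgue_measure_itv/= lte_fin; case: ifP => _.
  by rewrite -EFinB lee_fin.
by rewrite lee_fin.
Qed.

Theorem theorem4p1p1 (R : realType) (n k : nat)
    (A : 'cV[R]_n -> 'M[R]_n) (nu : R) (theta : 'cV[R]_n -> R)
    (n_ge2 : (2 <= n)%N)
    (k_range : (1 <= k <= n - 1)%N)
    (A_sym : forall x, (A x)^T = A x)
    (A_smooth : forall j l : 'I_n, smooth (fun x => A x j l))
    (nu_gt0 : 0 < nu)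
    (A_nondeg : forall x xi : 'cV[R]_n,
        nu^-1 * enorm xi <= enorm (A x *m xi) <= nu * enorm xi)
    (A_schwartz : forall j l : 'I_n,
        schwartz (fun x => A x j l - Ah R n k j l))
    (A_nontrapping : nontrapping A)
    (theta_smooth : smooth theta)
    (theta_range : forall x, 0 <= theta x <= 1)
    (theta_supp : closure [set x | theta x != 0] `<=` [set x | enorm x <= 2])
    (theta_eq1 : forall x, enorm x <= 1 -> theta x = 1) :
  exists c1 c2 c3 M1 : R,
    [/\ 0 < c1, 0 < c2, 0 < c3 & 0 < M1] /\
    forall (x xi : 'cV[R]_n) (rho : \bar R),
      enorm xi = 1 -> (1 < rho)%E -> ((2 * M1)%:E < rho)%E ->
      (* (i) *)
      (exists X Xi : R -> 'cV[R]_n,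
         bicharacteristic (truncated theta A (Ah R n k) rho) x xi setT X Xi) /\
      forall X Xi : R -> 'cV[R]_n,
        bicharacteristic (truncated theta A (Ah R n k) rho) x xi setT X Xi ->
        [/\ (* (ii) *)
            forall s : R, 0 < c1^-1 /\ c1^-1 <= enorm (Xi s) <= c1,
            (* (iii) *)
            exists s : R, outgoing M1 X s &
            (* (iv), (v) *)
            let E := [set s : R | 0 <= s /\ outgoing M1 X s] in
            let s0 := inf E in
            let I (j : nat) := [set s : R | 0 <= s <= s0 /\
                                  2 ^+ j <= enorm (X s) <= 2 ^+ j.+1] in
            [/\ E !=set0,
                forall s : R, s0 <= s ->
                  c2 * (s - s0) ^+ 2 + M1 ^+ 2 <= enorm (X s) ^+ 2 &
                forall j : nat, (1 <= j)%N ->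
                  (lebesgue_measure (I j) <= (c3 * 2 ^+ j)%:E)%E]].
Proof.
have supp4 x : 4 < sqn x -> theta x = 0.
  move=> x4; apply/eqP; apply: contraTT x4 => tx0; rewrite -leNgt.
  have : enorm x <= 2 by apply: theta_supp; apply: subset_closure.
  by rewrite -(@ler_pXn2r _ 2)// ?nnegrE ?enorm_ge0// enorm_sqr; lra.
have [C [K adm]] := truncated_admissible theta_smooth theta_range supp4 A_schwartz.
have C0 : 0 <= C := adm_C (adm +oo%E (ltry 1)).
pose M := far_radius n C.
have M4 : 4 <= M := far_radius_ge n C0.
have M0 : 0 <= M by lra.
have [c' c'P] := uniform_exit theta_eq1 adm M4 A_nontrapping.
pose c := `|c'|; have c0 : 0 <= c by exact: normr_ge0.
pose c1 := 2 * c + 3; have c11 : 1 <= c1 by rewrite /c1; lra.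
have c10 : 0 < c1 by lra.
exists c1, (1 / (2 * c1)), (4 + c), M; split.
  by split; rewrite ?divr_gt0//; lra.
move=> x xi rho xi1 rho1 rhoM.
pose a := truncated theta A (Ah R n k) rho.
have adma : admissible k C K a := adm rho rho1.
have near T X Xi : 0 <= T -> flow_in a [set s | 0 <= s <= T] X Xi ->
    sqn (X 0) <= M ^+ 2 -> 1 / 2 <= sqn (Xi 0) <= 2 -> exits a M T X Xi c.
  move=> T0 fl XM Xi2; apply: (exits_mono (ler_norm c')).
  exact: c'P rho1 rhoM T0 fl XM Xi2.
have v1 : sqn xi = 1 by rewrite -enorm_sqr xi1 expr1n.
split.
  have [X [Xi [X0 Xi0 fl]]] := complete_flow adma c0 near x v1.
  by exists X, Xi; split.
move=> X Xi [X0 Xi0 fl0].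
have fl : flow_in a setT X Xi by exact: fl0.
have v0 : sqn (Xi 0) = 1 by rewrite Xi0.
have flT T : flow_in a [set s | 0 <= s <= T] X Xi by exact: flow_in_sub fl.
(* negative times are handled by reversal *)
have pin s : pinched c1 (sqn (Xi s)).
  have [s0|s0] := leP 0 s; first by have := momentum_pinched adma c0 near s0 (flT s) v0.
  have s0' : 0 <= - s by lra.
  have flr : flow_in a [set r | 0 <= r <= - s]
      (fun r => X (0 - r)) (fun r => - Xi (0 - r)).
    exact: (flow_in_sub _ (flow_in_reverse (c := 0) fl)).
  have v0' : sqn (- Xi (0 - 0)) = 1 by rewrite sqnN subr0.
  have := momentum_pinched adma c0 near s0' flr v0'.
  by rewrite sqnN sub0r opprK.
(* by time 2 |x| + c + 1 the curve is outgoing *)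
pose T := 2 * enorm x + c + 1.
have ex0 := enorm_ge0 x.
have T0 : 0 <= T by rewrite /T; lra.
have [tau [/andP[tau0 tauT] inc _ out]] := a_priori adma c0 near T0 (flT T) v0.
have tau2 : tau <= 2 * enorm x.
  have := inc 0; rewrite lexx tau0 subr0 => /(_ isT) h.
  rewrite -(@ler_pXn2r _ 2)// ?nnegrE ?mulr_ge0// exprMn enorm_sqr -X0; lra.
have [t [tT tc Mt rt]] : exists t, [/\ 0 <= t <= T, t <= tau + c,
    M ^+ 2 <= sqn (X t) & 0 <= radial a (X t) (Xi t)].
  by case: out => // Tc; exfalso; move: Tc; rewrite /T; lra.
have outt : outgoing M X t by apply/(outgoingE fl).
have t0 : 0 <= t by case/andP: tT.
split=> [s||].
- by split; [rewrite invr_gt0|exact: pinched_enorm].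
- by exists t.
move=> E s0 I.
have E0 : E !=set0 by exists t.
have [s00 outs0] := first_outgoing_time adma fl M0 E0.
rewrite -/s0 in s00 outs0.
have s0t : s0 <= t.
  by apply: ge_inf; [exists 0 => s []|split].
have /(outgoingE fl _ M0)[rs0 Ms0] := outs0.
split=> //.
- move=> s s0s; rewrite enorm_sqr.
  have [p1 p2] := pin s0.
  have vs0 : 0 < sqn (Xi s0).
    rewrite lt_def sqn_ge0 andbT; apply/eqP => v00.
    by move: p1; rewrite v00 mulr0 ler10.
  have s0in : 0 <= s0 <= s by rewrite s00.
  have ss : s0 <= s <= s by rewrite s0s lexx.
  have [h _] := escape_from adma (flT s) s0in Ms0 rs0 vs0 ss.
  have lowv : 1 / (2 * c1) <= sqn (Xi s0) / 2.
    rewrite ler_pdivrMr; last by move: c10; clear; lra.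
    by move: p1; rewrite -/c1; clear; lra.
  by move: (ler_wpM2r (sqr_ge0 (s - s0)) lowv) Ms0 h; clear; lra.
- move=> j j1.
  have pow0 : 1 <= 2 ^+ j :> R by rewrite exprn_ege1// ler1n.
  (* s0 <= tau + c, and |X(s)|^2 >= (tau - s)^2 / 4 before tau *)
  have Isub : I j `<=` `[tau - 4 * 2 ^+ j, tau + c].
    move=> s [/andP[ss0 s0s] /andP[_ up]]; rewrite /= in_itv/=; apply/andP; split.
      have [ts|st] := leP tau s; first by move: ts pow0; clear; lra.
      have hs := inc s; rewrite ss0 (ltW st) in hs.
      have {}hs := hs isT.
      have : (tau - s) ^+ 2 <= (4 * 2 ^+ j) ^+ 2.
        have : enorm (X s) ^+ 2 <= (2 ^+ j.+1) ^+ 2.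
          by rewrite ler_pXn2r// nnegrE ?enorm_ge0// exprn_ge0.
        rewrite enorm_sqr [2 ^+ j.+1]exprS !exprMn; move: hs; clear.
        by set P := 2 ^+ j => hs; lra.
      rewrite ler_pXn2r// ?nnegrE; [by clear; lra|by move: st; clear; lra|].
      by rewrite mulr_ge0// exprn_ge0.
    by move: s0s s0t tc; clear; lra.
  have hc r : {for r, continuous (fun s => enorm (X s))}.
    have h := is_derive_continuous (is_derive_sqnX fl (Logic.I : setT r)).
    exact: (continuous_comp h (@sqrt_continuous R _)).
  have mI : measurable (I j).
    apply: measurable_realfun.closed_measurable.
    have -> : I j = `[0, s0]%classic `&`
        ((fun s => enorm (X s)) @^-1` `[2 ^+ j, 2 ^+ j.+1]%classic).
      by apply/seteqP; split => s /=; rewrite !in_itv.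
    apply: closedI; first exact: interval_closed.
    apply: (@preimage_closed _ _ (fun s => enorm (X s))).
      by move=> r _; exact: hc.
    exact: interval_closed.
  apply: (lebesgue_measure_sub_segment Isub) => //; last first.
    by apply: mulr_ge0; [move: c0|move: pow0]; clear; lra.
  by move: (ler_wpM2l c0 pow0); clear; lra.
Qed.
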